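(* Let $\alpha:I\to\mathbb{E}_1^{2k}$ be a non-null self-similar curve with constant p-shape curvatures $\tilde\kappa_1\ne0,\tilde\kappa_2\neq0,\dots,\tilde\kappa_{2k-1}\ne0$. Suppose that $\lambda_1^2,\lambda_2^2,\dots,\lambda_k^2$ are all different eigenvalues of the symmetric matrix $M^2$, where $M$ is the constant $2k\times2k$ matrix given in the context. Put $$b_1=\sqrt{\lambda_1^2-\tilde\kappa_1^2},\quad \theta_1=\lambda_1\sigma-\cosh^{-1}\!\left(\frac{\lambda_1}{\sqrt{\lambda_1^2-\tilde\kappa_1^2}}\right),\qquad b_i=\sqrt{\lambda_i^2+\tilde\kappa_1^2},\quad \theta_i=\lambda_i\sigma+\cos^{-1}\!\left(\frac{\lambda_i}{\sqrt{\lambda_i^2+\tilde\kappa_1^2}}\right)\ (i=2,\dots,k).$$ (i) If the unit vector $\mathbf{e}_1$ is timelike, then a parametric statement of the timelike self-similar curve $\alpha$ according to the spherical arc length parameter $\sigma$ can be written in the form $$\alpha(\sigma)=e^{\tilde\kappa_1\sigma}\Big(\tfrac{a_1}{b_1}\sinh\theta_1,\ \tfrac{a_1}{b_1}\cosh\theta_1,\ \tfrac{a_2}{b_2}\sin\theta_2,\ -\tfrac{a_2}{b_2}\cos\theta_2,\ \dots,\ \tfrac{a_k}{b_k}\sin\theta_k,\ -\tfrac{a_k}{b_k}\cos\theta_k\Big),$$ where the real different non-zero numbers $a_1,\dots,a_k$ are a solution of the system of $k$ algebraic quadratic equations $\mathbf{e}_1\cdot\mathbf{e}_1=-1$ and $\mathbf{e}_i\cdot\mathbf{e}_i=1$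 $(i=2,\dots,k)$ determined by the vectors $$\mathbf{e}_1=e^{-\tilde\kappa_1\sigma}\frac{d\alpha}{d\sigma},\quad \mathbf{e}_2=\frac{d\mathbf{e}_1}{d\sigma},\quad \mathbf{e}_3=\frac1{\tilde\kappa_2}\Big(-\mathbf{e}_1+\frac{d\mathbf{e}_2}{d\sigma}\Big),\quad \mathbf{e}_4=\frac1{\tilde\kappa_3}\Big(\tilde\kappa_2\mathbf{e}_2+\frac{d\mathbf{e}_3}{d\sigma}\Big),\ \dots,\ \mathbf{e}_k=\frac1{\tilde\kappa_{k-1}}\Big(\tilde\kappa_{k-2}\mathbf{e}_{k-2}+\frac{d\mathbf{e}_{k-1}}{d\sigma}\Big).$$ (ii) If the unit vector $\mathbf{e}_2$ is timelike, then a parametric representation of the spacelike self-similar curve $\alpha$ according to the spherical arc length parameter $\sigma$ can be written in the form $$\alpha(\sigma)=e^{\tilde\kappa_1\sigma}\Big(-\tfrac{a_1}{b_1}\cosh\theta_1,\ -\tfrac{a_1}{b_1}\sinh\theta_1,\ \tfrac{a_2}{b_2}\sin\theta_2,\ -\tfrac{a_2}{b_2}\cos\theta_2,\ \dots,\ \tfrac{a_k}{b_k}\sin\theta_k,\ -\tfrac{a_k}{b_k}\cos\theta_k\Big),$$ where the real different non-zero numbers $a_1,\dots,a_k$ are a solution of the system of $k$ algebraic quadratic equations $\mathbf{e}_2\cdot\mathbf{e}_2=-1$ and $\mathbf{e}_i\cdot\mathbf{e}_i=1$ $(i=1,3,4,\dots,k)$ determined by the vectors $$\mathbf{e}_1=e^{-\tilde\kappa_1\sigma}\frac{d\alpha}{d\sigma},\quad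 \mathbf{e}_2=-\frac{d\mathbf{e}_1}{d\sigma},\quad \mathbf{e}_3=\frac1{\tilde\kappa_2}\Big(\mathbf{e}_1+\frac{d\mathbf{e}_2}{d\sigma}\Big),\quad \mathbf{e}_4=\frac1{\tilde\kappa_3}\Big(-\tilde\kappa_2\mathbf{e}_2+\frac{d\mathbf{e}_3}{d\sigma}\Big),\ \dots,\ \mathbf{e}_k=\frac1{\tilde\kappa_{k-1}}\Big(\tilde\kappa_{k-2}\mathbf{e}_{k-2}+\frac{d\mathbf{e}_{k-1}}{d\sigma}\Big).$$
   Context: $\mathbb{E}_1^n$ is $\mathbb{R}^n$ with the Lorentzian inner product $\mathbf{x}\cdot\mathbf{y}=\mathbf{x}^TI^*\mathbf{y}$, $I^*=\mathrm{diag}(-1,1,\dots,1)$; here $n=2k$. A p-similarity is a map $f(x)=\mu\mathbf{A}x+\mathbf{b}$ with $\mu\ne0$ real, $\mathbf{A}$ pseudo-orthogonal ($\mathbf{A}^TI^*\mathbf{A}=I^*$) with $\det\mathbf{A}=1$, $\mathbf{b}\in\mathbb{R}^n$; these form the group $\mathbf{Sim}(\mathbb{E}_1^n)$. A non-null curve with arc length $s$ is equipped with a Frenet frame: a pseudo-orthonormal frame $\mathbf{e}_1,\dots,\mathbf{e}_n$ with $\mathbf{e}_1=d\alpha/ds$, $\varepsilon_\ell=\mathbf{e}_\ell\cdot\mathbf{e}_\ell\in\{\pm1\}$, satisfying $$\mathbf{e}_1'=\varepsilon_2\kappa_1\mathbf{e}_2,\quad \mathbf{e}_i'=-\varepsilon_{i-1}\kappa_{i-1}\mathbf{e}_{i-1}+\varepsilon_{i+1}\kappa_i\mathbf{e}_{i+1}\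 (2\le i\le n-1),\quad \mathbf{e}_n'=-\varepsilon_{n-1}\kappa_{n-1}\mathbf{e}_{n-1},$$ where $'=d/ds$, $\kappa_j>0$ for $1\le j\le n-2$ and $\kappa_{n-1}\neq0$. A spherical arc length parameter $\sigma$ is an arc length parameter of $s\mapsto\mathbf{e}_1(s)$, so $d\sigma=\kappa_1ds$. The p-shape curvatures are $\tilde\kappa_1=-\frac1{\kappa_1}\frac{d\kappa_1}{d\sigma}$ and $\tilde\kappa_i=\frac{\kappa_i}{\kappa_1}$ for $i=2,\dots,n-1$. A non-null curve $\alpha$ is self-similar if there is a one-parameter subgroup $G$ of $\mathbf{Sim}(\mathbb{E}_1^n)$ such that every $f\in G$ preserves $\alpha$ globally and $G$ acts transitively on $\alpha$; this means that all its p-shape curvatures are constant. $M$ is the constant tridiagonal $n\times n$ matrix with zero diagonal, superdiagonal entries $M_{12}=\varepsilon_2$, $M_{i,i+1}=\varepsilon_{i+1}\tilde\kappa_i$ $(2\le i\le n-1)$, and subdiagonal entries $M_{21}=-\varepsilon_1$, $M_{i+1,i}=-\varepsilon_i\tilde\kappa_i$ $(2\le i\le n-1)$; thus $\frac{d}{d\sigma}(\mathbf{e}_1,\dots,\mathbf{e}_n)^T=M(\mathbf{e}_1,\dots,\mathbf{e}_n)^T$.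
   Formalization: For i≥2 the eigenvalues of M² are −λ_i² (only one can be positive); λ_1>|κ̃_1| is assumed; α has the form up to scale, translation and a pseudo-orthogonal map; the a_i are different if the system has a different non-zero solution (for k≥4 it may not). *)

(* Defs.v *)
From HB Require Import structures.
From mathcomp Require Import all_boot all_order all_algebra.
From mathcomp Require Import all_classical all_reals all_analysis.

Set Implicit Arguments.
Unset Strict Implicit.
Unset Printing Implicit Defensive.

Import Order.TTheory GRing.Theory Num.Theory.
Import numFieldNormedType.Exports.

Local Open Scope classical_set_scope.
Local Open Scope ring_scope.

(* Families written x_1, ..., x_n on paper (frame vectors, causal signs,
   curvatures, eigenvalue parameters, amplitudes) are functions on [nat] that
   are only used at the indices 1, ..., n.  Matrix and vector entries carry
   MathComp's 0-based ordinals. *)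

Definition sinh {R : realType} (x : R) : R := (expR x - expR (- x)) / 2.
Definition cosh {R : realType} (x : R) : R := (expR x + expR (- x)) / 2.

(* The inverse of [cosh : [0, +oo[ -> [1, +oo[]. *)
Definition acosh {R : realType} (x : R) : R := ln (x + Num.sqrt (x ^+ 2 - 1)).

Definition lorentz_mx (R : realType) (n : nat) : 'M[R]_n :=
  diag_mx (\row_(i < n) if (i : nat) == 0%N then -1 else 1).

Definition lorentz {R : realType} {n : nat} (x y : 'cV[R]_n) : R :=
  \tr (x^T *m lorentz_mx R n *m y).

Definition pseudo_orthogonal {R : realType} {n : nat} (A : 'M[R]_n) : Prop :=
  A^T *m lorentz_mx R n *m A = lorentz_mx R n.

Definition affine_map {R : realType} {n : nat} (mu : R) (A : 'M[R]_n)
    (b x : 'cV[R]_n) : 'cV[R]_n := mu *: (A *m x) + b.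

Definition p_similarity {R : realType} {n : nat} (f : 'cV[R]_n -> 'cV[R]_n) :
    Prop :=
  exists (mu : R) (A : 'M[R]_n) (b : 'cV[R]_n),
    [/\ mu != 0, pseudo_orthogonal A, \det A = 1 & f = affine_map mu A b].

(* A continuous homomorphism from (R, +) to the group of p-similarities. *)
Definition one_parameter_subgroup {R : realType} {n : nat}
    (phi : R -> 'cV[R]_n -> 'cV[R]_n) : Prop :=
  [/\ forall t, p_similarity (phi t),
      forall s t, phi (s + t) = phi s \o phi t
    & forall (x : 'cV[R]_n) (i : 'I_n), continuous (fun t => phi t x i ord0)].

Definition self_similar {R : realType} {n : nat} (I : set R)
    (alpha : R -> 'cV[R]_n) : Prop :=
  exists phi : R -> 'cV[R]_n -> 'cV[R]_n,
    [/\ one_parameter_subgroup phi,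
        forall t, phi t @` (alpha @` I) = alpha @` I
      & forall x y, (alpha @` I) x -> (alpha @` I) y ->
          exists t, phi t x = y].

(* Differentiation of vector-valued functions is coordinatewise. *)
Definition vderives {R : realType} {n : nat} (f : R -> 'cV[R]_n) (s : R)
    (df : 'cV[R]_n) : Prop :=
  forall i : 'I_n, is_derive s 1 (fun t => f t i ord0) (df i ord0).

Definition vderive {R : realType} {n : nat} (f : R -> 'cV[R]_n) (s : R) :
    'cV[R]_n :=
  \col_i derive1 (fun t => f t i ord0) s.

(* [alpha], parametrized by its arc length on [I], is a non-null curve with
   Frenet frame [e i], causal signs [eps i] and curvatures [kappa i]. *)
Record frenet_curve {R : realType} {n : nat} (I : set R)
    (alpha : R -> 'cV[R]_n) (e : nat -> R -> 'cV[R]_n) (eps : nat -> R)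
    (kappa : nat -> R -> R) : Prop := FrenetCurve {
  frenet_sign : forall i, (1 <= i <= n)%N -> eps i = 1 \/ eps i = -1;
  frenet_orthonormal : forall s i j, I s -> (1 <= i <= n)%N -> (1 <= j <= n)%N ->
    lorentz (e i s) (e j s) = if i == j then eps i else 0;
  frenet_tangent : forall s, I s -> vderives alpha s (e 1%N s);
  frenet_first : forall s, I s ->
    vderives (e 1%N) s ((eps 2%N * kappa 1%N s) *: e 2%N s);
  frenet_middle : forall s i, I s -> (2 <= i <= n.-1)%N ->
    vderives (e i) s (- (eps i.-1 * kappa i.-1 s) *: e i.-1 s
                      + (eps i.+1 * kappa i s) *: e i.+1 s);
  frenet_last : forall s, I s ->
    vderives (e n) s (- (eps n.-1 * kappa n.-1 s) *: e n.-1 s);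
  frenet_kappa_gt0 : forall s i, I s -> (1 <= i <= n.-2)%N -> 0 < kappa i s;
  frenet_kappa_last : forall s, I s -> kappa n.-1 s != 0;
  frenet_kappa_derivable : forall s i, I s -> (1 <= i <= n.-1)%N ->
    derivable (kappa i) s 1 }.

(* d sigma = kappa_1 ds *)
Definition spherical_arc_length {R : realType} (I : set R)
    (kappa : nat -> R -> R) (sigma : R -> R) : Prop :=
  forall s, I s -> is_derive s 1 sigma (kappa 1%N s).

(* The p-shape curvatures, as functions of the arc length [s]; for a function
   [h] of [s], d h / d sigma is [derive1 h s / derive1 sigma s]. *)
Definition pshape_curvature {R : realType} (kappa : nat -> R -> R)
    (sigma : R -> R) (i : nat) (s : R) : R :=
  if i == 1%N then - (kappa 1%N s)^-1 * (derive1 (kappa 1%N) s / derive1 sigma s)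
  else kappa i s / kappa 1%N s.

(* The coefficient kappa_i / kappa_1 of the Frenet equations with respect to
   sigma, given the p-shape curvatures [tk]; note that it is 1, not [tk 1],
   for i = 1. *)
Definition frenet_coef {R : realType} (tk : nat -> R) (i : nat) : R :=
  if i == 1%N then 1 else tk i.

Definition shape_mx {R : realType} (n : nat) (eps tk : nat -> R) : 'M[R]_n :=
  \matrix_(i < n, j < n)
    if (j : nat) == i.+1 then eps i.+2 * frenet_coef tk i.+1
    else if (i : nat) == j.+1 then - (eps j.+1 * frenet_coef tk j.+1)
    else 0.

(* [shape_mx] is skew with respect to a Lorentzian form, so its square has one
   positive eigenvalue, lambda_1^2 (a hyperbolic plane, giving sinh and cosh),
   and the other ones are negative, -lambda_i^2 (rotation planes, giving sin
   and cos). *)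
Definition sq_eigenvalue {R : realType} (lam : nat -> R) (i : nat) : R :=
  if i == 1%N then lam 1%N ^+ 2 else - lam i ^+ 2.

Definition form_b {R : realType} (tk lam : nat -> R) (i : nat) : R :=
  if i == 1%N then Num.sqrt (lam 1%N ^+ 2 - tk 1%N ^+ 2)
  else Num.sqrt (lam i ^+ 2 + tk 1%N ^+ 2).

Definition form_theta {R : realType} (tk lam : nat -> R) (i : nat)
    (sigma : R) : R :=
  if i == 1%N then lam 1%N * sigma - acosh (lam 1%N / form_b tk lam 1)
  else lam i * sigma + acos (lam i / form_b tk lam i).

(* The entries of (0-based) indices 2 (p - 1) and 2 (p - 1) + 1 make up the
   p-th pair of coordinates, where p = 1, ..., k. *)
Definition timelike_form {R : realType} (k : nat) (tk lam a : nat -> R)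
    (sigma : R) : 'cV[R]_(2 * k) :=
  \col_(i < 2 * k)
    let p := (i./2).+1 in
    let th := form_theta tk lam p sigma in
    expR (tk 1%N * sigma) *
      (if p == 1%N then
         if odd i then a p / form_b tk lam p * cosh th
         else a p / form_b tk lam p * sinh th
       else
         if odd i then - (a p / form_b tk lam p) * cos th
         else a p / form_b tk lam p * sin th).

Definition spacelike_form {R : realType} (k : nat) (tk lam a : nat -> R)
    (sigma : R) : 'cV[R]_(2 * k) :=
  \col_(i < 2 * k)
    let p := (i./2).+1 in
    let th := form_theta tk lam p sigma in
    expR (tk 1%N * sigma) *
      (if p == 1%N then
         if odd i then - (a p / form_b tk lam p) * sinh th
         else - (a p / form_b tk lam p) * cosh th
       else
         if odd i then - (a p / form_b tk lam p) * cos th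
         else a p / form_b tk lam p * sin th).

(* The pair (e_i, e_(i+1)) of vector fields determined by a curve [c] with
   parameter sigma through
     e_1 = exp (- tk_1 sigma) dc/dsigma,
     e_(i+1) = eps_(i+1) / g_i *: (eps_(i-1) g_(i-1) e_(i-1) + de_i/dsigma),
   where g = frenet_coef tk and e_0 = 0; in particular
   e_2 = eps_2 de_1/dsigma and e_3 = (eps_3 / tk_2) (eps_1 e_1 + de_2/dsigma). *)
Fixpoint derived_frame_pair {R : realType} {n : nat} (eps tk : nat -> R)
    (c : R -> 'cV[R]_n) (i : nat) : (R -> 'cV[R]_n) * (R -> 'cV[R]_n) :=
  match i with
  | 0%N => (fun=> 0, fun sigma => expR (- (tk 1%N * sigma)) *: vderive c sigma)
  | j.+1 =>
    let u := (derived_frame_pair eps tk c j).1 in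
    let v := (derived_frame_pair eps tk c j).2 in
    (v, fun sigma =>
      (eps j.+2 / frenet_coef tk j.+1) *:
        ((eps j * frenet_coef tk j) *: u sigma + vderive v sigma))
  end.

Definition derived_frame {R : realType} {n : nat} (eps tk : nat -> R)
    (c : R -> 'cV[R]_n) (i : nat) : R -> 'cV[R]_n :=
  (derived_frame_pair eps tk c i).1.

(* The causal signs of a frame whose only timelike vector is e_j. *)
Definition one_timelike {R : realType} (j i : nat) : R :=
  if i == j then -1 else 1.

(* The k quadratic equations e_i . e_i = eps_i, i = 1, ..., k, in the unknowns
   a_1, ..., a_k, for the frame determined by the curve [form a]. *)
Definition quadratic_system {R : realType} {n : nat} (k : nat)
    (eps tk : nat -> R) (form : (nat -> R) -> R -> 'cV[R]_n) (a : nat -> R) :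
    Prop :=
  forall i, (1 <= i <= k)%N -> forall sigma,
    lorentz (derived_frame eps tk (form a) i sigma)
            (derived_frame eps tk (form a) i sigma) = eps i.

Definition pairwise_different {R : realType} (k : nat) (a : nat -> R) : Prop :=
  forall i j, (1 <= i <= k)%N -> (1 <= j <= k)%N -> i != j -> a i != a j.

(* The curve s |-> c (sigma s) is, on [I], a copy of [alpha] in other
   pseudo-orthonormal coordinates (of either orientation), up to scale. *)
Definition has_parametrization {R : realType} {n : nat} (I : set R)
    (alpha : R -> 'cV[R]_n) (sigma : R -> R) (c : R -> 'cV[R]_n) : Prop :=
  exists (mu : R) (A : 'M[R]_n) (b : 'cV[R]_n),
    [/\ mu != 0, pseudo_orthogonal A
      & forall s, I s -> alpha s = affine_map mu A b (c (sigma s))].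

(* [alpha] can be written as [form a], for some non-zero solution [a] of the
   quadratic system; [a] is pairwise different as soon as the system has any
   pairwise different non-zero solution. *)
Definition has_explicit_form {R : realType} {n : nat} (k : nat) (I : set R)
    (alpha : R -> 'cV[R]_n) (sigma : R -> R) (eps tk : nat -> R)
    (form : (nat -> R) -> R -> 'cV[R]_n) : Prop :=
  exists a : nat -> R,
    [/\ forall i, (1 <= i <= k)%N -> a i != 0,
        (exists a' : nat -> R,
           [/\ forall i, (1 <= i <= k)%N -> a' i != 0,
               pairwise_different k a' & quadratic_system k eps tk form a']) ->
          pairwise_different k a,
        quadratic_system k eps tk form a
      & has_parametrization I alpha sigma (form a)].

(* Main.v *)
Require Import Defs.
From mathcomp Require Import all_boot all_order all_algebra.
From mathcomp Require Import all_classical all_reals all_analysis.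
From mathcomp Require Import ring lra zify.
Import Order.TTheory GRing.Theory Num.Theory.
Import numFieldNormedType.Exports.
Local Open Scope classical_set_scope.
Local Open Scope ring_scope.

(* On the plane of an eigenvalue mu of M^2, the Frenet recursion makes e_(i+1)
   equal to t_i(mu) times e_1 (i even) or de_1/dsigma (i odd), for polynomials
   t_i that depend only on the curvatures.  The orthonormality of the frame is
   thus a Gauss quadrature rule for the t_i, with nodes the eigenvalues and
   with weights the Lorentzian squares of the components of e_1 in the planes;
   as M is skew for the Lorentzian form and its nodes are distinct, such
   weights exist, and their signs are those prescribed by the causal character.
   The first k equations e_i . e_i = eps_i determine the weights, hence the
   a_p^2, since the i-th one involves a polynomial of exact degree i - 1 in mu.
   Every solution a of the system therefore gives an orthonormal frame E with
   E' = M E, and E^T D F is constant for the frame F of alpha, because D M is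
   skew; so F differs from E by a constant pseudo-orthogonal matrix. *)

(** * Quadrature for the shape matrix *)

Lemma sum_pairs {R : realType} (k : nat) (F : nat -> R) :
  \sum_(j < 2 * k) F j = \sum_(r < k) (F r.*2 + F r.*2.+1).
Proof.
rewrite mul2n -!(big_mkord xpredT) -!(big_mkord xpredT (fun r => F r.*2 + F r.*2.+1)).
elim: k => [|m IH]; first by rewrite !big_geq.
by rewrite doubleS !big_nat_recr //= IH addrA.
Qed.

(* Testing against the Lagrange polynomials isolates the individual weights. *)
Lemma node_weights_eq0 {R : realType} (k : nat) (h : nat -> {poly R})
    (mu d : nat -> R) :
  (forall i, (i < k)%N -> size (h i) = i.+1) ->
  (forall r s, (r < k)%N -> (s < k)%N -> mu r = mu s -> r = s) ->
  (forall i, (i < k)%N -> \sum_(r < k) d r * (h i).[mu r] = 0) ->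
  forall r, (r < k)%N -> d r = 0.
Proof.
move=> size_h mu_inj sum_h.
(* The polynomials [h 0], ..., [h (m - 1)] have consecutive degrees, so they span all polynomials of
   size at most [m]; the vanishing extends to these by linearity. *)
have sum_p m : (m <= k)%N -> forall p : {poly R}, (size p <= m)%N ->
    \sum_(r < k) d r * p.[mu r] = 0.
  elim: m => [_ p|m IH hm p sp].
    rewrite leqn0 size_poly_eq0 => /eqP ->.
    by rewrite big1 // => r _; rewrite horner0 mulr0.
  (* Subtracting [c *: h m] cancels the coefficient of degree [m], which lowers the size. *)
  pose c := p`_m / lead_coef (h m).
  have l0 : lead_coef (h m) != 0 by rewrite lead_coef_eq0 -size_poly_eq0 size_h.
  have := IH (ltnW hm) (p - c *: h m).
  under eq_bigr do rewrite hornerD hornerN hornerZ mulrBr mulrCA.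
  rewrite sumrB -mulr_sumr sum_h // mulr0 subr0; apply.
  apply/leq_sizeP => j; rewrite leq_eqVlt => /predU1P[<-|hj].
    rewrite coefB coefZ /c lead_coefE size_h //= -mulrA mulVf ?mulr1 ?subrr //.
    by move: l0; rewrite lead_coefE size_h.
  rewrite coefB coefZ !nth_default ?mulr0 ?subrr ?size_h //.
  exact: leq_trans sp hj.
move=> r hr; pose r0 := Ordinal hr.
(* The Lagrange numerator: it vanishes at every node except [mu r], and its size is exactly [k]. *)
pose p : {poly R} := \prod_(s <- enum (predC1 r0)) ('X - (mu s)%:P).
have sp : (size p <= k)%N.
  by rewrite size_prod_XsubC -cardE cardC1 card_ord prednK //; lia.
have pr0 : p.[mu r] != 0.
  rewrite horner_prod prodf_seq_neq0; apply/allP => s; rewrite mem_enum /= inE => hs.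
  rewrite hornerXsubC subr_eq0; apply/eqP => e; case/eqP: hs; apply/val_inj.
  by apply: mu_inj => //=.
have := sum_p k (leqnn k) p sp.
rewrite (bigD1 r0) //= big1 ?addr0.
  by move/eqP; rewrite mulf_eq0 (negbTE pr0) orbF => /eqP.
move=> s hs; suff -> : p.[mu s] = 0 by rewrite mulr0.
rewrite horner_prod; apply/eqP; rewrite prodf_seq_eq0; apply/hasP; exists s.
  by rewrite mem_enum.
by rewrite hornerXsubC subrr eqxx.
Qed.

(* The convention e_0 = 0. *)
Definition shifted {R : realType} (w : nat -> R) (i : nat) : R :=
  if i is j.+1 then w j else 0.

(** The recursion of [derived_frame_pair] on one plane, with indices shifted so that [frame_poly i]
    belongs to e_(i+1). Differentiating e_1 gives de_1/dsigma at no cost, while differentiating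
    de_1/dsigma gives mu times e_1; hence the factor ['X] at odd [i] only. *)
Fixpoint frame_poly_pair {R : realType} (eps tk : nat -> R) (i : nat) :
    {poly R} * {poly R} :=
  match i with
  | 0%N => (0, 1)
  | j.+1 =>
    let u := (frame_poly_pair eps tk j).1 in
    let v := (frame_poly_pair eps tk j).2 in
    (v, (eps j.+2 / frenet_coef tk j.+1) *:
          ((eps j * frenet_coef tk j) *: u + (if odd j then 'X else 1) * v))
  end.

Definition frame_poly {R : realType} (eps tk : nat -> R) (i : nat) : {poly R} :=
  (frame_poly_pair eps tk i).2.

Lemma frame_poly_horner_rec {R : realType} (eps tk : nat -> R) (x : R) (i : nat) :
  (frame_poly eps tk i.+1).[x] =
  eps i.+2 / frenet_coef tk i.+1 *
    (eps i * frenet_coef tk i * shifted (fun j => (frame_poly eps tk j).[x]) i +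
     (if odd i then x else 1) * (frame_poly eps tk i).[x]).
Proof.
rewrite /frame_poly /= hornerZ hornerD hornerZ hornerM.
by case: i => [|i] /=; rewrite ?if_neg; try case: (odd i) => /=;
  rewrite ?hornerX ?hornerC ?horner0.
Qed.

Lemma shape_mx_col {R : realType} (n : nat) (eps tk w : nat -> R) (i : 'I_n) :
  (shape_mx n eps tk *m \col_j w j) i ord0 =
  (if (i.+1 < n)%N then eps i.+2 * frenet_coef tk i.+1 * w i.+1 else 0)
  - eps i * frenet_coef tk i * shifted w i.
Proof.
rewrite mxE.
under eq_bigr do rewrite !mxE.
(* Row [i] is split into its two possible entries. For [i = 0] the truncated predecessor [i.-1] is 0
   again, but the second term is then zero because [shifted w 0 = 0]. *)
rewrite (eq_bigr (fun j : 'I_n =>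
    (if (j : nat) == i.+1 then eps i.+2 * frenet_coef tk i.+1 * w i.+1 else 0)
  + (if (j : nat) == i.-1 then - (eps i * frenet_coef tk i * shifted w i) else 0))).
  rewrite big_split /=; congr (_ + _).
    case: ltnP => hi; last first.
      by rewrite big1 // => j _; case: eqP => // hj; move: (ltn_ord j); lia.
    rewrite (bigD1 (Ordinal hi)) //= eqxx big1 ?addr0 // => j hj.
    by case: eqP => // h; case/eqP: hj; apply/val_inj.
  have hi : (i.-1 < n)%N by move: (ltn_ord i); lia.
  rewrite (bigD1 (Ordinal hi)) //= eqxx big1 ?addr0 // => j hj.
  by case: eqP => // h; case/eqP: hj; apply/val_inj.
move=> j _; case: eqP => [hj|hj].
  have -> : ((j : nat) == i.-1) = false by apply/eqP; lia.
  by rewrite hj addr0.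
case: eqP => [->|hi] /=; first by rewrite eqxx add0r mulNr.
rewrite mul0r add0r; case: eqP => // h.
have -> : (i : nat) = 0%N by lia.
by rewrite /= mulr0 oppr0.
Qed.

(** The recursion is linear and its term of index -1 is zero, so a solution is determined by, and
    proportional to, its initial value. *)
Lemma frame_poly_unique {R : realType} (n : nat) (eps tk : nat -> R) (x : R)
    (z : nat -> R) :
  (forall i, (i.+1 < n)%N ->
    z i.+1 = eps i.+2 / frenet_coef tk i.+1 *
      (eps i * frenet_coef tk i * shifted z i + (if odd i then x else 1) * z i)) ->
  forall i, (i < n)%N -> z i = z 0%N * (frame_poly eps tk i).[x].
Proof.
move=> hz i.
have [m] := ubnP i; elim: m i => // m IH [|i] hm hi.
  by rewrite /frame_poly /= hornerC mulr1.
rewrite hz // frame_poly_horner_rec (IH i) //; last exact: ltnW.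
case: i hm hi => [|i] hm hi /=; first by ring.
by rewrite (IH i) //; [ring|lia|lia].
Qed.

(** * Eigenvectors of the square of the shape matrix *)

Section ShapeSpectrum.
Context {R : realType} (k : nat) (eps tk : nat -> R).
Local Notation n := (2 * k)%N.
Local Notation f := (frenet_coef tk).
Local Notation M := (shape_mx n eps tk).
Local Notation t := (frame_poly eps tk).
Hypothesis k_gt0 : (0 < k)%N.
Hypothesis epsK : forall i, eps i * eps i = 1.
Hypothesis f_neq0 : forall i, (0 < i < n)%N -> f i != 0.

Lemma eps_neq0 i : eps i != 0.
Proof.
by apply/eqP => h; move: (epsK i); rewrite h mul0r => /esym/eqP; rewrite oner_eq0.
Qed.

(** The superdiagonal entries are invertible, so each row but the last can be solved for the next
    unknown; the last row remains as a constraint. *)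
Lemma shape_mx_solve (w w' : nat -> R) :
  M *m (\col_j w j) = \col_j w' j ->
  (forall i, (i.+1 < n)%N ->
     w i.+1 = eps i.+2 / f i.+1 * (eps i * f i * shifted w i + w' i)) /\
  - eps n.-1 * f n.-1 * w n.-2 = w' n.-1.
Proof.
move=> h; have E (i : 'I_n) : (if (i.+1 < n)%N then eps i.+2 * f i.+1 * w i.+1 else 0)
  - eps i * f i * shifted w i = w' i by rewrite -shape_mx_col h mxE.
split=> [i hi|].
  have hi' : (i < n)%N by exact: ltnW.
  have := E (Ordinal hi'); rewrite /= hi => <-.
  rewrite addrC subrK; have f0 := f_neq0 i.+1; rewrite hi /= in f0.
  rewrite !mulrA (mulrAC _ _ (eps _)) epsK mul1r mulVf ?mul1r //.
  exact: f0.
have hn : (n.-1 < n)%N by lia.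
have := E (Ordinal hn); rewrite /= prednK; last by lia.
rewrite ltnn sub0r => <-.
have e1 : n.-1 = n.-2.+1 by lia.
by rewrite [X in shifted w X]e1 /= -!mulNr.
Qed.

(** At 0 the factor ['X] disappears, so going from one even index to the next only multiplies the
    value by a nonzero constant. *)
Lemma frame_poly_even0_neq0 i : (i < n)%N -> ~~ odd i -> (t i).[0] != 0.
Proof.
have [m] := ubnP i; elim: m i => // m IH [|[|i]] hm hi //= ev.
  by rewrite /frame_poly /= hornerC oner_eq0.
have {}ev : ~~ odd i by move: ev; rewrite /= !negbK.
rewrite frame_poly_horner_rec /= ev mul0r addr0.
by rewrite !mulf_neq0 ?invr_eq0 ?eps_neq0 ?f_neq0 ?IH //; lia.
Qed.

Lemma shape_mx_eigen (w w' : nat -> R) (x : R) :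
  M *m (\col_j w j) = \col_j w' j -> M *m (\col_j w' j) = \col_j (x * w j) ->
  (forall i, (i < n)%N -> (if odd i then w i else w' i) = w' 0%N * (t i).[x]) /\
  w' 0%N * (- eps n.-1 * f n.-1 * (t n.-2).[x]) = w' 0%N * (x * (t n.-1).[x]).
Proof.
move=> /(shape_mx_solve w w')[h1 _] /(shape_mx_solve w' (fun j => x * w j))[h2 b].
(* [M] exchanges the parities of indices, so the odd entries of [w] and the even entries of [w']
   form a closed subsystem, governed by the recursion of [frame_poly]. *)
pose z i := if odd i then w i else w' i.
have hz : forall i, (i < n)%N -> z i = w' 0%N * (t i).[x].
  apply: frame_poly_unique => i hi; rewrite /z /=.
  case: (boolP (odd i)) => oi /=.
    by rewrite h2 //; case: i oi hi {h1 h2 b} => //= i; case: (odd i).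
  rewrite h1 //; case: i oi hi {h1 h2 b} => [|i] //=; first by rewrite mul1r.
  by case: (odd i); rewrite //= mul1r.
split=> //.
have o1 : odd n.-1 by rewrite -subn1 oddB ?oddM //; lia.
have o2 : odd n.-2 = false by rewrite -subn2 oddB ?oddM //; lia.
have := hz n.-1; rewrite /z o1 => e1.
have := hz n.-2; rewrite /z o2 => e2.
rewrite mulrCA -e2; last by lia.
by rewrite b mulrCA -e1 //; lia.
Qed.

(** For a kernel vector, the odd entries vanish by [shape_mx_eigen] with [w' = 0], and the even ones
    are multiples of [w 0] by the nonzero numbers [(t i).[0]]. As the size is even, [n.-2] is an
    even index, and the last row forces [w 0 = 0]. *)
Lemma shape_mx_inj (w : nat -> R) :
  M *m (\col_(j < n) w j) = 0 -> forall i, (i < n)%N -> w i = 0.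
Proof.
move=> h; have h0 : M *m (\col_(j < n) w j) = \col_(j < n) 0.
  by rewrite h; apply/colP => j; rewrite !mxE.
have [hr b] := shape_mx_solve w (fun=> 0) h0.
have wodd i : (i < n)%N -> odd i -> w i = 0.
  have h1 : M *m (\col_(j < n) (fun=> 0 : R) j) = \col_(j < n) (0 * w j).
    apply/colP => j; rewrite !mxE big1 ?mul0r // => l _.
    by rewrite !mxE mulr0.
  have [H _] := shape_mx_eigen w (fun=> 0) 0 h0 h1.
  by move=> hi oi; have := H i hi; rewrite oi mul0r.
have weven i : (i < n)%N -> ~~ odd i -> w i = w 0%N * (t i).[0].
  have [m] := ubnP i; elim: m i => // m IH [|[|i]] hm hi //= ev.
    by rewrite /frame_poly /= hornerC mulr1.
  have {}ev : ~~ odd i by move: ev; rewrite /= !negbK.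
  rewrite hr // frame_poly_horner_rec /= ev /= addr0 mul0r addr0 (IH i) //; [ring|lia|lia].
have o2 : ~~ odd n.-2 by rewrite -subn2 oddB ?oddM //; lia.
have w0 : w 0%N = 0.
  move: b; rewrite weven //; last by lia.
  move=> /eqP; rewrite !mulf_eq0 oppr_eq0 (negbTE (eps_neq0 _)) /=.
  have -> : (f n.-1 == 0) = false by apply/negbTE/f_neq0; lia.
  have /negbTE -> : (t n.-2).[0] != 0 by apply: frame_poly_even0_neq0 => //; lia.
  by rewrite orbF => /eqP.
move=> i hi; case: (boolP (odd i)) => oi; first exact: wodd.
by rewrite weven // w0 mul0r.
Qed.

(** The Gram matrix prescribed for the Frenet frame. *)
Definition sign_mx : 'M[R]_n := diag_mx (\row_i eps i.+1).

Lemma sign_mx_sqr : sign_mx *m sign_mx = 1%:M.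
Proof.
rewrite /sign_mx mulmx_diag; apply/matrixP => i j; rewrite !mxE epsK.
by case: eqP.
Qed.

Lemma shape_mx_skew : M *m sign_mx = - (sign_mx *m M^T).
Proof.
rewrite /sign_mx; apply/matrixP => i j; rewrite mul_mx_diag mul_diag_mx !mxE.
case: eqP => [->|h1].
  case: eqP => [|_]; first by lia.
  by rewrite mulrAC epsK mulrN opprK mulrA epsK.
case: eqP => [->|h2]; last by ring.
by rewrite mulNr mulrAC epsK mulrA epsK.
Qed.

(** Extension by zero, to apply the results on families indexed by [nat] to a given column. *)
Definition nat_ext (u : 'cV[R]_n) (i : nat) : R :=
  if insub i is Some j then u j ord0 else 0.

Lemma nat_extK (u : 'cV[R]_n) : \col_i nat_ext u i = u.
Proof. by apply/colP => i; rewrite mxE /nat_ext valK. Qed.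

(* The last Frenet equation, at the level of the polynomials [t]. *)
Definition frame_boundary (x : R) : Prop :=
  - eps n.-1 * f n.-1 * (t n.-2).[x] = x * (t n.-1).[x].

Lemma shape_mx_sqr_eigenvalue (x : R) :
  eigenvalue (M *m M) x -> x != 0 /\ frame_boundary x.
Proof.
move=> /eigenvalueP[v hv v0].
(* [eigenvalue] provides a row eigenvector. Skewness turns it into a column one: passing [M] through
   [sign_mx] costs a transpose and a sign, and the two signs cancel in [M *m M]. *)
pose u := sign_mx *m v^T.
have Msign (y : 'cV[R]_n) : M *m (sign_mx *m y) = - (sign_mx *m (M^T *m y)).
  by rewrite mulmxA shape_mx_skew mulNmx mulmxA.
have hu : M *m (M *m u) = x *: u.
  by rewrite /u Msign mulmxN Msign opprK -!trmx_mul -mulmxA hv linearZ scalemxAr.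
have u0 : u != 0.
  apply: contra_neq v0 => h0.
  have : sign_mx *m u = 0 by rewrite h0 mulmx0.
  rewrite /u mulmxA sign_mx_sqr.
  by rewrite mul1mx => /(congr1 trmx); rewrite trmxK trmx0.
pose w := nat_ext u; pose w' := nat_ext (M *m u).
have h1 : M *m (\col_j w j) = \col_j w' j by rewrite !nat_extK.
have h2 : M *m (\col_j w' j) = \col_j (x * w j).
  by rewrite nat_extK hu; apply/colP => j; rewrite [LHS]mxE [RHS]mxE /w /nat_ext valK.
have w_neq0 : ~ (forall i, (i < n)%N -> w i = 0).
  move=> h; case/eqP: u0; rewrite -(nat_extK u); apply/colP => i.
  by rewrite [LHS]mxE [RHS]mxE; exact: h.
have x0 : x != 0.
  apply/eqP => x0; apply: w_neq0; apply: shape_mx_inj.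
  rewrite h1; apply/colP => i; rewrite !mxE.
  apply: (shape_mx_inj w') => //; rewrite h2.
  by apply/colP => j; rewrite !mxE x0 mul0r.
split=> //.
have [h3 h4] := shape_mx_eigen w w' x h1 h2.
(* [shape_mx_eigen] gives the boundary equation only up to the factor [w' 0]. If that is zero, the
   pair [(w', x w)] gives it up to the factor [x * w 0]; were both zero, [w] would vanish at odd and
   at even indices. *)
have [w'0|] := eqVneq (w' 0%N) 0; last by move=> /mulfI; apply.
have h5 : M *m (\col_j (x * w j)) = \col_j (x * w' j).
  have -> : \col_(j < n) (x * w j) = x *: \col_j w j by apply/colP => j; rewrite !mxE.
  by rewrite -scalemxAr h1; apply/colP => j; rewrite !mxE.
have [h6 h7] := shape_mx_eigen w' (fun j => x * w j) x h2 h5.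
have [w0|/mulfI] := eqVneq (x * w 0%N) 0; last by apply.
case: w_neq0 => i hi; have := h3 i hi; have := h6 i hi.
case: (odd i) => [_ ->|+ _]; first by rewrite w'0 mul0r.
by rewrite w0 mul0r => /eqP; rewrite mulf_eq0 (negbTE x0) => /eqP.
Qed.

(** The parts of the sequence [(t i).[x]] of either parity. When [x] satisfies [frame_boundary],
    they span an invariant plane of [M], on which [M] squares to [x]. *)
Definition even_frame (x : R) (i : nat) : R := if odd i then 0 else (t i).[x].
Definition odd_frame (x : R) (i : nat) : R := if odd i then (t i).[x] else 0.

(** All rows but the last restate the recursion; the last one is [frame_boundary]. *)
Lemma shape_mx_frame (x : R) (i : 'I_n) : frame_boundary x ->
  (if (i.+1 < n)%N then eps i.+2 * f i.+1 * (t i.+1).[x] else 0)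
  - eps i * f i * shifted (fun j => (t j).[x]) i = (if odd i then x else 1) * (t i).[x].
Proof.
move=> hb; case: ltnP => hi.
  rewrite frame_poly_horner_rec.
  have f0 : f i.+1 != 0 by apply: f_neq0.
  rewrite mulrA (_ : _ * _ * (_ / _) = 1) ?mul1r; first by ring.
  by rewrite mulrA (mulrAC _ _ (eps _)) epsK mul1r mulfV.
have e1 : (i : nat) = n.-1 by move: (ltn_ord i); lia.
have e2 : n.-1 = n.-2.+1 by lia.
rewrite sub0r e1 [X in shifted _ X]e2 /= -!mulNr hb.
have -> // : odd n.-1 by rewrite -subn1 oddB ?oddM //; lia.
Qed.

Lemma shape_mx_odd_frame (x : R) : frame_boundary x ->
  M *m (\col_j odd_frame x j) = \col_j even_frame x j.
Proof.
move=> hb; apply/colP => i; rewrite shape_mx_col mxE /odd_frame /even_frame /=.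
have := shape_mx_frame x i hb.
case: (boolP (odd i)) => oi.
  move=> _; have -> : shifted (fun j => if odd j then (t j).[x] else 0) i = 0.
    by case: (i : nat) oi => //= j; case: odd.
  by rewrite !mulr0 subr0; case: ifP.
rewrite /= mul1r => <-; congr (_ - _ * _).
by case: (i : nat) oi => //= j; case: odd.
Qed.

Lemma shape_mx_even_frame (x : R) : frame_boundary x ->
  M *m (\col_j even_frame x j) = x *: \col_j odd_frame x j.
Proof.
move=> hb; apply/colP => i; rewrite shape_mx_col !mxE /odd_frame /even_frame /=.
have := shape_mx_frame x i hb.
case: (boolP (odd i)) => oi /=.
  move=> <-; congr (_ - _ * _).
  by case: (i : nat) oi => //= j; case: odd.
move=> _; have -> : shifted (fun j => if odd j then 0 else (t j).[x]) i = 0.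
  by case: (i : nat) oi => //= j; case: odd.
by rewrite !mulr0 subr0; case: ifP.
Qed.

(** The degree rises only when the recursion multiplies by ['X], that is every second step; the
    other summand has strictly smaller size, so the leading term cannot cancel. *)
Lemma size_frame_poly (i : nat) : (i < n)%N -> size (t i) = i./2.+1.
Proof.
have [m] := ubnP i; elim: m i => // m IH [|i] hm hi.
  by rewrite /frame_poly /= size_poly1.
have c0 : eps i.+2 / frenet_coef tk i.+1 != 0.
  by rewrite mulf_neq0 ?invr_eq0 ?eps_neq0 // f_neq0.
have ti : size (t i) = i./2.+1 by apply: IH; lia.
rewrite /frame_poly /= size_scale // addrC; case: i hm hi c0 ti => [|i] hm hi c0 ti.
  by rewrite /= scaler0 addr0 mulr1 size_poly1.
have ti' : size (t i) = i./2.+1 by apply: IH; lia.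
have st (a : R) : (size (a *: t i) <= i./2.+1)%N by rewrite -ti' size_scale_leq.
have -> : (frame_poly_pair eps tk i.+1).1 = t i by [].
have -> : (frame_poly_pair eps tk i.+1).2 = t i.+1 by [].
have s1 : size ((if odd i.+1 then 'X else 1) * t i.+1) = (i.+2)./2.+1.
  case: ifP => oi; last by rewrite mul1r ti; lia.
  rewrite mulrC size_mulX ?ti; first by lia.
  by rewrite -size_poly_eq0 ti.
by rewrite size_polyDl s1 //; apply: leq_ltn_trans (st _) _; lia.
Qed.

Lemma frame_weights_unique (mu W W' : nat -> R) :
  (forall r s, (r < k)%N -> (s < k)%N -> mu r = mu s -> r = s) ->
  (forall i, (i < k)%N ->
    \sum_(r < k) W r * (if odd i then - mu r else 1) * (t i).[mu r] * (t i).[mu r] =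
    \sum_(r < k) W' r * (if odd i then - mu r else 1) * (t i).[mu r] * (t i).[mu r]) ->
  forall r, (r < k)%N -> W r = W' r.
Proof.
move=> mu_inj hW r hr; apply/eqP; rewrite -subr_eq0; apply/eqP.
(* The factor [- 'X] at odd [i] compensates for the halved degree of [t i]: [h i] has degree exactly
   [i], as [node_weights_eq0] requires. *)
pose h i := (if odd i then - 'X else 1) * (t i * t i).
apply: (node_weights_eq0 k h mu (fun r => W r - W' r)) => // i hi.
  have ti : size (t i) = i./2.+1 by apply: size_frame_poly; lia.
  have t0 : t i != 0 by rewrite -size_poly_eq0 ti.
  have := odd_double_half i.
  rewrite /h; case: ifP => oi /=.
    rewrite mulNr size_polyN mulrC size_mulX ?mulf_neq0 // size_mul // ti; lia.
  rewrite mul1r size_mul // ti; lia.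
move: (hW i hi) => /eqP; rewrite -subr_eq0 -sumrB => /eqP hW0.
rewrite -[RHS]hW0; apply: eq_bigr => s _; rewrite /h.
by case: ifP => oi; rewrite !hornerE /=; ring.
Qed.

Lemma shape_mx_skewT : M^T *m sign_mx = - (sign_mx *m M).
Proof.
have : sign_mx *m (M *m sign_mx) *m sign_mx =
       sign_mx *m (- (sign_mx *m M^T)) *m sign_mx by rewrite shape_mx_skew.
rewrite -!mulmxA sign_mx_sqr mulmx1 mulNmx mulmxN -mulmxA mulmxA sign_mx_sqr mul1mx.
by move=> ->; rewrite opprK.
Qed.

(** * Orthogonality of the invariant planes and the quadrature rule *)

Section Quadrature.
Variable mu : nat -> R.
Hypothesis mu_inj : forall r s, (r < k)%N -> (s < k)%N -> mu r = mu s -> r = s.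
Hypothesis mu_neq0 : forall r, (r < k)%N -> mu r != 0.
Hypothesis mu_boundary : forall r, (r < k)%N -> frame_boundary (mu r).

Definition sign_dot (u v : nat -> R) : R := \sum_(i < n) eps i.+1 * u i * v i.

Lemma sign_dotE (u v : nat -> R) :
  (\col_j u j)^T *m sign_mx *m (\col_j v j) = (sign_dot u v)%:M.
Proof.
apply/matrixP => a b; rewrite !ord1 !mxE mulr1n; apply: eq_bigr => i _.
by rewrite /sign_mx mul_mx_diag !mxE; ring.
Qed.

Lemma sign_dotC (u v : nat -> R) : sign_dot u v = sign_dot v u.
Proof. by apply: eq_bigr => i _; ring. Qed.

(** Write [even_frame x] as [M] applied to [odd_frame x], and move [M] to the other argument by
    skewness. *)
Lemma sign_dot_frames (x y : R) : frame_boundary x -> frame_boundary y ->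
  sign_dot (even_frame x) (even_frame y) =
  - y * sign_dot (odd_frame x) (odd_frame y).
Proof.
move=> hx hy.
have := sign_dotE (even_frame x) (even_frame y).
rewrite -(shape_mx_odd_frame _ hx) trmx_mul -(mulmxA _ M^T) shape_mx_skewT.
rewrite mulmxN mulNmx mulmxA -mulmxA (shape_mx_even_frame _ hy) -scalemxAr sign_dotE.
by move=> /matrixP/(_ 0 0); rewrite !mxE /= !mulr1n mulNr => <-.
Qed.

(** The left side of [sign_dot_frames] is symmetric in its two nodes, so the product in question is
    unchanged in value when weighted by [mu r] or by [mu s], which differ. *)
Lemma sign_dot_odd_frame (r s : nat) : (r < k)%N -> (s < k)%N -> r != s ->
  sign_dot (odd_frame (mu r)) (odd_frame (mu s)) = 0.
Proof.
move=> hr hs rs.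
have h1 := sign_dot_frames _ _ (mu_boundary r hr) (mu_boundary s hs).
have h2 := sign_dot_frames _ _ (mu_boundary s hs) (mu_boundary r hr).
rewrite sign_dotC h2 (sign_dotC (odd_frame (mu s))) in h1.
have /eqP : (mu s - mu r) * sign_dot (odd_frame (mu r)) (odd_frame (mu s)) = 0.
  rewrite mulrBl; move: h1; lra.
rewrite mulf_eq0 subr_eq0 => /orP[/eqP h|/eqP//].
by case/eqP: rs; apply: mu_inj.
Qed.

Lemma sign_dot_even_frame (r s : nat) : (r < k)%N -> (s < k)%N -> r != s ->
  sign_dot (even_frame (mu r)) (even_frame (mu s)) = 0.
Proof.
move=> hr hs rs; rewrite sign_dot_frames ?sign_dot_odd_frame ?mulr0 //; exact: mu_boundary.
Qed.

Lemma sign_dot_odd_even (x y : R) : sign_dot (odd_frame x) (even_frame y) = 0.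
Proof.
rewrite /sign_dot big1 // => i _; rewrite /odd_frame /even_frame.
by case: odd; rewrite ?mulr0 ?mul0r.
Qed.

(** Its inverse is the weight of the node [mu r] in the quadrature rule. *)
Definition node_norm (r : nat) : R := sign_dot (even_frame (mu r)) (even_frame (mu r)).

Hypothesis node_norm_neq0 : forall r, (r < k)%N -> node_norm r != 0.

(** The vectors [even_frame] and [odd_frame] of all nodes form an orthogonal basis. The rule is the
    dual statement, on the columns of the matrix whose rows are these vectors. *)
Lemma quadrature (i j : nat) : (i < n)%N -> (j < n)%N -> odd i = odd j ->
  \sum_(r < k) (node_norm r)^-1 * (if odd i then - mu r else 1) *
     (t i).[mu r] * (t j).[mu r] = if i == j then eps i.+1 else 0.
Proof.
move=> hi hj oij.
(* Rows [2 r] and [2 r + 1] are the even and odd parts at the node [mu r]; [N] lists their squares,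
   the odd one being obtained from [sign_dot_frames]. *)
pose fr (l : nat) := (if odd l then odd_frame else even_frame) (mu l./2).
pose T : 'M[R]_n := \matrix_(l, m) fr l m.
pose N (l : nat) := if odd l then - node_norm l./2 / mu l./2 else node_norm l./2.
have half_lt (l : 'I_n) : (l./2 < k)%N by move: (ltn_ord l); lia.
have N0 (l : 'I_n) : N l != 0.
  by rewrite /N; case: ifP => _; rewrite ?mulf_neq0 ?oppr_eq0 ?invr_eq0 ?node_norm_neq0 ?mu_neq0.
have fr_ortho (l m : 'I_n) : sign_dot (fr l) (fr m) = if l == m then N l else 0.
  rewrite /fr /N; case: eqP => [<-|lm].
    case: ifP => // _; rewrite /node_norm sign_dot_frames; try exact: mu_boundary.
    by field; apply: mu_neq0.
  have hlm : odd l = odd m -> l./2 != m./2.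
    move=> h; apply/eqP => h'; apply: lm; apply/val_inj => /=.
    by rewrite -(odd_double_half l) -(odd_double_half m) h h'.
  case: (boolP (odd l)) hlm => ol; case: (boolP (odd m)) => om hlm.
  - by rewrite sign_dot_odd_frame ?hlm.
  - exact: sign_dot_odd_even.
  - by rewrite sign_dotC; exact: sign_dot_odd_even.
  - by rewrite sign_dot_even_frame ?hlm.
have TDT : T *m (sign_mx *m T^T *m diag_mx (\row_l (N l)^-1)) = 1%:M.
  apply/matrixP => l m; rewrite !mulmxA mul_mx_diag !mxE.
  have -> : \sum_j (T *m sign_mx) l j * T^T j m = sign_dot (fr l) (fr m).
    by apply: eq_bigr => a _; rewrite /sign_mx mul_mx_diag !mxE; ring.
  rewrite fr_ortho; case: eqP => [<-|_]; last by rewrite mul0r.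
  by rewrite divff.
(* A right inverse of a square matrix is a left inverse: row orthogonality becomes column
   orthogonality. *)
have /(congr1 (mulmx sign_mx)) := mulmx1C TDT.
rewrite !mulmxA sign_mx_sqr mul1mx mulmx1 => /matrixP/(_ (Ordinal hi) (Ordinal hj)).
rewrite !mxE /= => h.
have -> : (if i == j then eps i.+1 else 0) = eps i.+1 *+ (Ordinal hi == Ordinal hj).
  by rewrite -val_eqE /=; case: eqP.
rewrite -h; under [RHS]eq_bigr do rewrite mul_mx_diag !mxE.
rewrite (sum_pairs k (fun l => fr l i / N l * fr l j)).
apply: eq_bigr => r _; rewrite /fr /N /= odd_double uphalf_double doubleK.
rewrite /odd_frame /even_frame /= -oij.
have n0 := node_norm_neq0 _ (ltn_ord r); have m0 := mu_neq0 _ (ltn_ord r).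
by case: (odd i) => /=; field; rewrite ?n0 ?m0.
Qed.

End Quadrature.
End ShapeSpectrum.

(** * Curves oscillating in orthogonal planes *)

Lemma lorentzE {R : realType} (n : nat) (x y : 'cV[R]_n) :
  lorentz x y =
  \sum_(i < n) (if (i : nat) == 0%N then -1 else 1) * x i ord0 * y i ord0.
Proof.
rewrite /lorentz /lorentz_mx /mxtrace big_ord1 mxE; apply: eq_bigr => i _.
by rewrite mul_mx_diag !mxE; ring.
Qed.

Section OscillatingCurve.
Context {R : realType} (k : nat) (eps tk mu : nat -> R) (y dy : nat -> R -> R).
Local Notation n := (2 * k)%N.
Local Notation f := (frenet_coef tk).
Local Notation t := (frame_poly eps tk).
Hypothesis y_derive : forall j (s : R), is_derive s 1 (y j) (dy j s).
Hypothesis dy_derive : forall j (s : R), is_derive s 1 (dy j) (mu j./2 * y j s).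

Definition osc_curve (s : R) : 'cV[R]_n := \col_j (expR (tk 1%N * s) * y j s).
(* With [y'' = mu * y] in each plane, [osc_tangent] is exp (- tk_1 s) times the
   derivative of [osc_curve]. *)
Definition osc_tangent (j : nat) (s : R) : R := tk 1%N * y j s + dy j s.
Definition osc_tangent' (j : nat) (s : R) : R := tk 1%N * dy j s + mu j./2 * y j s.

(** Closed form of the derived vector e_(i+1) of [osc_curve]; coordinate [j] lies in the plane of
    index [j./2]. *)
Definition osc_frame (i : nat) (s : R) : 'cV[R]_n :=
  \col_j ((t i).[mu j./2] * (if odd i then osc_tangent' j s else osc_tangent j s)).

Lemma osc_tangent_derive (j : nat) (s : R) :
  is_derive s 1 (osc_tangent j) (osc_tangent' j s).
Proof.
have h1 := y_derive j s; have h2 := dy_derive j s.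
by rewrite /osc_tangent /osc_tangent'; apply: is_derive_eq.
Qed.

Lemma osc_tangent'_derive (j : nat) (s : R) :
  is_derive s 1 (osc_tangent' j) (mu j./2 * osc_tangent j s).
Proof.
have h1 := y_derive j s; have h2 := dy_derive j s.
rewrite /osc_tangent /osc_tangent'; apply: is_derive_eq.
by rewrite /GRing.scale /=; ring.
Qed.

Lemma osc_curve_derive (j : 'I_n) (s : R) :
  is_derive s 1 (fun s => osc_curve s j ord0) (expR (tk 1%N * s) * osc_tangent j s).
Proof.
have h1 := y_derive j s; rewrite /osc_curve /osc_tangent.
have -> : (fun s => (\col_(j < n) (expR (tk 1%N * s) * y j s)) j ord0) =
          (fun s => expR (tk 1%N * s)) * y j.
  by apply/funext => u; rewrite mxE.
apply: is_derive_eq; rewrite /GRing.scale /=; ring.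
Qed.

Lemma osc_frame_derive (i : nat) (j : 'I_n) (s : R) :
  is_derive s 1 (fun s => osc_frame i s j ord0)
    ((t i).[mu j./2] *
     (if odd i then mu j./2 * osc_tangent j s else osc_tangent' j s)).
Proof.
have h1 := osc_tangent_derive j s; have h2 := osc_tangent'_derive j s.
have -> : (fun s => osc_frame i s j ord0) =
   (t i).[mu j./2] *: (if odd i then osc_tangent' j else osc_tangent j).
  by apply/funext => u; rewrite mxE; case: odd.
by case: odd; apply: is_derive_eq.
Qed.

(** Differentiation exchanges [osc_tangent] and [osc_tangent'], with a factor [mu] in one direction,
    just as ['X] alternates in [frame_poly]. The induction carries two consecutive vectors because
    the recursion has two steps. *)
Lemma derived_frame_osc (i : nat) : derived_frame eps tk osc_curve i.+1 = osc_frame i.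
Proof.
have pairE : derived_frame_pair eps tk osc_curve i =
    (if i is j.+1 then osc_frame j else fun=> 0, osc_frame i).
  elim: i => [|i IH] /=.
    congr pair; apply/funext => s; apply/colP => j; rewrite !mxE.
    have h := osc_curve_derive j s.
    rewrite derive1E derive_val mulrA -expRD addrC subrr expR0 mul1r.
    by rewrite /frame_poly /= hornerC mul1r.
  rewrite IH; congr pair; apply/funext => s; apply/colP => j; rewrite !mxE /=.
  have h := osc_frame_derive i j s.
  rewrite derive1E derive_val frame_poly_horner_rec -[RHS]mulrA; congr (_ * _).
  rewrite mulrDl; case: i {IH h} => [|i] /=; rewrite !mxE.
    by rewrite /frame_poly /= !hornerC; ring.
  by case: odd => /=; ring.
by rewrite /derived_frame /= pairE.
Qed.

(** In each plane, e_1 and its derivative are orthogonal with squares [W r] and [- mu r * W r].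
    Products of vectors of different parity therefore vanish, and the others become weighted sums
    over the nodes. *)
Lemma lorentz_osc_frame (W : nat -> R) (s : R) :
  (forall r, (r < k)%N ->
     let sg : R := if r == 0%N then -1 else 1 in
     [/\ sg * osc_tangent r.*2 s ^+ 2 + osc_tangent r.*2.+1 s ^+ 2 = W r,
         sg * osc_tangent r.*2 s * osc_tangent' r.*2 s
         + osc_tangent r.*2.+1 s * osc_tangent' r.*2.+1 s = 0
       & sg * osc_tangent' r.*2 s ^+ 2 + osc_tangent' r.*2.+1 s ^+ 2 = - mu r * W r]) ->
  forall i j, lorentz (osc_frame i s) (osc_frame j s) =
    if odd i == odd j then
      \sum_(r < k) W r * (if odd i then - mu r else 1) * (t i).[mu r] * (t j).[mu r]
    else 0.
Proof.
move=> hW i j; rewrite lorentzE.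
pose F l := (if l == 0%N then -1 else 1) *
  ((t i).[mu l./2] * (if odd i then osc_tangent' l s else osc_tangent l s)) *
  ((t j).[mu l./2] * (if odd j then osc_tangent' l s else osc_tangent l s)).
transitivity (\sum_(l < n) F l); first by apply: eq_bigr => l _; rewrite !mxE.
rewrite sum_pairs.
have -> : (if odd i == odd j then
      \sum_(r < k) W r * (if odd i then - mu r else 1) * (t i).[mu r] * (t j).[mu r]
    else 0) = \sum_(r < k) (if odd i == odd j then
      W r * (if odd i then - mu r else 1) * (t i).[mu r] * (t j).[mu r] else 0).
  by case: ifP => // _; rewrite big1.
apply: eq_bigr => r _; have := hW r (ltn_ord r); rewrite /F /= uphalf_double doubleK.
have -> : (r.*2 == 0)%N = (r == 0 :> nat)%N by lia.
set sg := if _ then _ else _.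
move=> [e1 e2 e3].
case: (odd i); case: (odd j) => /=.
- rewrite [W r * _]mulrC -e3; ring.
- by rewrite -[RHS](mul0r ((t i).[mu r] * (t j).[mu r])) -e2; ring.
- by rewrite -[RHS](mul0r ((t i).[mu r] * (t j).[mu r])) -e2; ring.
- by rewrite -e1; ring.
Qed.

End OscillatingCurve.

(** * Hyperbolic functions and the planar components of the explicit forms *)

Lemma is_derive_sinh {R : realType} (x : R) : is_derive x 1 sinh (cosh x).
Proof.
have -> : @sinh R = (2^-1 : R) *: (expR - (fun x => expR (- x))).
  by apply/funext => u; rewrite /sinh mulrC.
by apply: is_derive_eq; rewrite /cosh /GRing.scale /=; field.
Qed.

Lemma is_derive_cosh {R : realType} (x : R) : is_derive x 1 cosh (sinh x).
Proof.
have -> : @cosh R = (2^-1 : R) *: (expR + (fun x => expR (- x))).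
  by apply/funext => u; rewrite /cosh mulrC.
by apply: is_derive_eq; rewrite /sinh /GRing.scale /=; field.
Qed.

Lemma cosh2_sinh2 {R : realType} (x : R) : cosh x ^+ 2 - sinh x ^+ 2 = 1.
Proof.
have h : expR x * expR (- x) = 1 by rewrite -expRD subrr expR0.
by rewrite /cosh /sinh -[RHS]h; field.
Qed.

Lemma is_derive_comp1 {R : realType} (g h : R -> R) (s dg dh : R) :
  is_derive s 1 h dh -> is_derive (h s) 1 g dg ->
  is_derive s 1 (fun u => g (h u)) (dg * dh).
Proof. by move=> h1 h2; apply: is_derive_eq; rewrite mulrC. Qed.

Section ExplicitForms.
Context {R : realType} (k : nat) (tk lam : nat -> R).
Hypothesis tk_lam : `|tk 1%N| < lam 1%N.
Hypothesis tk_neq0 : tk 1%N != 0.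

Definition node (r : nat) : R := sq_eigenvalue lam r.+1.

(** The coordinates of [timelike_form] and [spacelike_form] without the exponential factor, so that
    both forms are instances of [osc_curve] by unfolding. *)
Definition form_coord (spacelike : bool) (a : nat -> R) (j : nat) (s : R) : R :=
  let p := (j./2).+1 in
  let th := form_theta tk lam p s in
  if p == 1%N then
    if spacelike then
      if odd j then - (a p / form_b tk lam p) * sinh th
      else - (a p / form_b tk lam p) * cosh th
    else
      if odd j then a p / form_b tk lam p * cosh th
      else a p / form_b tk lam p * sinh th
  else
    if odd j then - (a p / form_b tk lam p) * cos th
    else a p / form_b tk lam p * sin th.

Definition form_coord' (spacelike : bool) (a : nat -> R) (j : nat) (s : R) : R :=
  let p := (j./2).+1 in
  let th := form_theta tk lam p s in
  if p == 1%N then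
    if spacelike then
      if odd j then - (lam p * a p / form_b tk lam p) * cosh th
      else - (lam p * a p / form_b tk lam p) * sinh th
    else
      if odd j then lam p * a p / form_b tk lam p * sinh th
      else lam p * a p / form_b tk lam p * cosh th
  else
    if odd j then lam p * a p / form_b tk lam p * sin th
    else lam p * a p / form_b tk lam p * cos th.

(* The phases are constants, so no property of [acos] and [acosh] is needed. *)
Lemma form_theta_derive (p : nat) (s : R) :
  is_derive s 1 (form_theta tk lam p) (lam p).
Proof.
pose c := form_theta tk lam p 0.
have -> : form_theta tk lam p = (lam p *: id) + cst c.
  apply/funext => u; rewrite /c /form_theta /cst /=.
  have -> : (lam p *: id + (fun=> c)) u = lam p * u + c by [].
  by rewrite /c /form_theta; case: ifP => [/eqP ->|_]; rewrite mulr0 add0r.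
by apply: is_derive_eq; rewrite addr0 /GRing.scale /= mulr1.
Qed.

Lemma form_coord_derive (b : bool) (a : nat -> R) (j : nat) (s : R) :
  is_derive s 1 (form_coord b a j) (form_coord' b a j s).
Proof.
rewrite /form_coord /form_coord'; set p := (j./2).+1.
have hth := form_theta_derive p s.
have hsh := is_derive_comp1 _ _ _ _ _ hth (is_derive_sinh _).
have hch := is_derive_comp1 _ _ _ _ _ hth (is_derive_cosh _).
have hsi := is_derive_comp1 _ _ _ _ _ hth (is_derive_sin _).
have hco := is_derive_comp1 _ _ _ _ _ hth (is_derive_cos _).
by case: (p == 1%N); case: (odd j); case: b; apply: is_derive_eq;
  rewrite /GRing.scale /=; ring.
Qed.

Lemma form_coord'_derive (b : bool) (a : nat -> R) (j : nat) (s : R) :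
  is_derive s 1 (form_coord' b a j) (node j./2 * form_coord b a j s).
Proof.
rewrite /form_coord /form_coord' /node; set p := (j./2).+1.
have -> : sq_eigenvalue lam p = if p == 1%N then lam p ^+ 2 else - lam p ^+ 2.
  by rewrite /sq_eigenvalue; case: eqP => [->|].
have hth := form_theta_derive p s.
have hsh := is_derive_comp1 _ _ _ _ _ hth (is_derive_sinh _).
have hch := is_derive_comp1 _ _ _ _ _ hth (is_derive_cosh _).
have hsi := is_derive_comp1 _ _ _ _ _ hth (is_derive_sin _).
have hco := is_derive_comp1 _ _ _ _ _ hth (is_derive_cos _).
by case: (p == 1%N); case: (odd j); case: b; apply: is_derive_eq;
  rewrite /GRing.scale /=; ring.
Qed.

(* The square of the component of e_1 in the r-th plane. *)
Definition form_weight (b : bool) (a : nat -> R) (r : nat) : R :=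
  if ~~ b && (r == 0%N) then - a r.+1 ^+ 2 else a r.+1 ^+ 2.

(** The component of e_1 in a plane is [tk 1] times the position plus the velocity. Its square is
    that of [a / form_b] times [lam ^+ 2] minus or plus [tk 1 ^+ 2], up to sign, and [form_b] is the
    root that normalises this factor. *)
Lemma form_coord_planes (b : bool) (a : nat -> R) (s : R) (r : nat) :
  let x := osc_tangent tk (form_coord b a) (form_coord' b a) in
  let dx := osc_tangent' tk node (form_coord b a) (form_coord' b a) in
  let sg : R := if r == 0%N then -1 else 1 in
  [/\ sg * x r.*2 s ^+ 2 + x r.*2.+1 s ^+ 2 = form_weight b a r,
      sg * x r.*2 s * dx r.*2 s + x r.*2.+1 s * dx r.*2.+1 s = 0
    & sg * dx r.*2 s ^+ 2 + dx r.*2.+1 s ^+ 2 = - node r * form_weight b a r].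
Proof.
rewrite /osc_tangent /osc_tangent' /form_coord /form_coord' /form_weight /node.
rewrite /sq_eigenvalue /= odd_double /= uphalf_double doubleK.
case: r => [|r] /=.
  set B := form_b tk lam 1.
  (* The bound on [tk 1] keeps the radicand positive; otherwise [Num.sqrt] would not square back to
     it, or division by zero would occur. *)
  have sq_gt0 : 0 < lam 1%N ^+ 2 - tk 1%N ^+ 2.
    by move: tk_lam; rewrite ltr_norml subr_sqr => /andP[h1 h2];
       apply: mulr_gt0; lra.
  have hB : B ^+ 2 = lam 1%N ^+ 2 - tk 1%N ^+ 2.
    by rewrite /B /form_b /= sqr_sqrtr // ltW.
  have B0 : B != 0 by rewrite -sqrf_eq0 hB gt_eqF.
  have := cosh2_sinh2 (form_theta tk lam 1 s).
  move: (cosh _) (sinh _) => C S hCS.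
  (* Inserting [C ^+ 2 - S ^+ 2], which equals 1, makes the goals identities in [C] and [S] as free
     variables. *)
  have hA : a 1%N ^+ 2 = (a 1%N / B) ^+ 2 * (lam 1%N ^+ 2 - tk 1%N ^+ 2) * (C ^+ 2 - S ^+ 2).
    by rewrite hCS -hB mulr1 expr_div_n divfK // expf_neq0.
  by case: b => /=; split; rewrite ?hA; field.
have lamsq : 0 < lam r.+2 ^+ 2 + tk 1%N ^+ 2.
  by rewrite ltr_wpDl ?sqr_ge0 // lt0r sqrf_eq0 tk_neq0 sqr_ge0.
set B := form_b tk lam r.+2.
have hB : B ^+ 2 = lam r.+2 ^+ 2 + tk 1%N ^+ 2.
  by rewrite /B /form_b /= sqr_sqrtr // ltW.
have B0 : B != 0 by rewrite -sqrf_eq0 hB gt_eqF.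
have := cos2Dsin2 (form_theta tk lam r.+2 s).
move: (cos _) (sin _) => C S hCS.
have hA : a r.+2 ^+ 2 = (a r.+2 / B) ^+ 2 * (lam r.+2 ^+ 2 + tk 1%N ^+ 2) * (C ^+ 2 + S ^+ 2).
  by rewrite hCS -hB mulr1 expr_div_n divfK // expf_neq0.
by rewrite andbF; split; rewrite ?hA; field.
Qed.

End ExplicitForms.

(** * Frenet curves with constant shape curvatures *)

Lemma is_derive0_interval {R : realType} (I : set R) (g : R -> R) :
  is_interval I -> (forall s, I s -> is_derive s 1 g 0) ->
  forall x y, I x -> I y -> g x = g y.
Proof.
move=> itvI dg x y; wlog xy : x y / x <= y => [H|].
  by case/orP: (le_total x y) => ? *; [apply: H|symmetry; apply: H].
move=> Ix Iy.
have dgI z : z \in `[x, y] -> is_derive z 1 g 0.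
  by rewrite in_itv /= => hz; apply: dg; apply: itvI hz.
have dgo z : z \in `]x, y[ -> is_derive z 1 g ((fun=> 0) z).
  by move=> hz; apply: dgI; apply: subset_itv_oo_cc.
have cg : {within `[x, y], continuous g}.
  by apply: derivable_within_continuous => z /dgI[].
have [c _] := @MVT_segment R g (fun=> 0) x y xy dgo cg.
by rewrite mul0r => /eqP; rewrite subr_eq0 => /eqP.
Qed.

(** The derivative of E^T D F is g E^T (M^T D + D M) F, which vanishes by skewness. *)
Lemma skew_ode_gram {R : realType} (n : nat) (I : set R) (g : R -> R)
    (M : 'M[R]_n) (d : 'rV[R]_n) (E F : R -> 'M[R]_n) :
  is_interval I -> M^T *m diag_mx d = - (diag_mx d *m M) ->
  (forall s i j, I s -> is_derive s 1 (fun u => E u i j) (g s * (M *m E s) i j)) ->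
  (forall s i j, I s -> is_derive s 1 (fun u => F u i j) (g s * (M *m F s) i j)) ->
  forall s u, I s -> I u ->
    (E s)^T *m diag_mx d *m F s = (E u)^T *m diag_mx d *m F u.
Proof.
move=> itvI skewM dE dF s u Is Iu; apply/matrixP => i j.
have entry v : ((E v)^T *m diag_mx d *m F v) i j =
    (\sum_(l < n) (d 0 l *: ((fun u => E u l i) * (fun u => F u l j)))) v.
  rewrite fct_sumE mxE; apply: eq_bigr => l _; rewrite mul_mx_diag !mxE.
  by rewrite -[RHS]/(d 0 l * (E v l i * F v l j)); ring.
rewrite !entry; apply: is_derive0_interval Is Iu => // v Iv.
have h1 l := dE v l i Iv; have h2 l := dF v l j Iv.
apply: is_derive_eq.
transitivity (g v * (((M *m E v)^T *m diag_mx d *m F v) i j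
                     + ((E v)^T *m diag_mx d *m (M *m F v)) i j)); last first.
  rewrite trmx_mul -(mulmxA _ M^T) skewM mulmxN mulNmx !mulmxA.
  by rewrite [X in X + _]mxE addNr mulr0.
rewrite !mxE -big_split mulr_sumr; apply: eq_bigr => l _.
rewrite !mul_mx_diag !mxE /GRing.scale /=; ring.
Qed.

(** Constancy of E^T D F, together with E L E^T = D, expresses [F s] as [E s] times a matrix
    independent of [s]. That matrix preserves [L] because both frames have Gram matrix D. *)
Lemma congruent_frames {R : realType} (n : nat) (I : set R) (g : R -> R)
    (M L : 'M[R]_n) (d : 'rV[R]_n) (E F : R -> 'M[R]_n) :
  is_interval I -> I !=set0 -> M^T *m diag_mx d = - (diag_mx d *m M) ->
  diag_mx d *m diag_mx d = 1%:M ->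
  (forall s i j, I s -> is_derive s 1 (fun u => E u i j) (g s * (M *m E s) i j)) ->
  (forall s i j, I s -> is_derive s 1 (fun u => F u i j) (g s * (M *m F s) i j)) ->
  (forall s, I s -> E s *m L *m (E s)^T = diag_mx d) ->
  (forall s, I s -> F s *m L *m (F s)^T = diag_mx d) ->
  L^T = L ->
  exists A : 'M[R]_n, A^T *m L *m A = L /\ forall s, I s -> F s = E s *m A^T.
Proof.
set D := diag_mx d => itvI [s0 Is0] skewM DD dE dF EE FF LT.
have DT : D^T = D by exact: tr_diag_mx.
(* The inverse of [E s0], read off from E L E^T = D and D D = 1. *)
pose P := L *m (E s0)^T *m D.
exists (P *m F s0)^T; split; last first.
  move=> s Is; rewrite trmxK /P -!mulmxA (mulmxA (E s0)^T).
  rewrite -(skew_ode_gram _ _ _ _ _ _ _ itvI skewM dE dF s s0 Is Is0).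
  by rewrite !mulmxA (EE s Is) DD mul1mx.
have PT : P^T = D *m E s0 *m L by rewrite /P !trmx_mul LT DT trmxK mulmxA.
have PE : P *m E s0 = 1%:M.
  by apply: mulmx1C; rewrite /P !mulmxA EE // DD.
have -> : (P *m F s0)^T^T *m L *m (P *m F s0)^T =
          P *m (F s0 *m L *m (F s0)^T) *m P^T.
  by rewrite trmxK (trmx_mul P) !mulmxA.
by rewrite FF // PT !mulmxA -(mulmxA P) DD mulmx1 PE mul1mx.
Qed.

Lemma lorentz_rows {R : realType} (n : nat) (w : nat -> 'cV[R]_n) (i j : 'I_n) :
  let E : 'M[R]_n := \matrix_(l, m) w l m ord0 in
  (E *m lorentz_mx R n *m E^T) i j = lorentz (w i) (w j).
Proof.
move=> E; rewrite lorentzE mxE; apply: eq_bigr => l _.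
by rewrite /E /lorentz_mx mul_mx_diag !mxE; ring.
Qed.

(** The combination of [u] and [v] without time coordinate has nonnegative square, yet by
    orthogonality its square is minus the sum of the squares of their time coordinates. So [u]
    itself has no time coordinate and cannot be timelike. *)
Lemma orthogonal_timelike_absurd {R : realType} (n : nat) (i0 : 'I_n) (u v : 'cV[R]_n) :
  (i0 : nat) = 0%N -> lorentz u u = -1 -> lorentz v v = -1 -> lorentz u v = 0 -> False.
Proof.
move=> i0E uu vv uv.
have nonneg (z : 'cV[R]_n) : z i0 ord0 = 0 -> 0 <= lorentz z z.
  move=> z0; rewrite lorentzE; apply: sumr_ge0 => i _; case: eqP => hi.
    have -> : i = i0 by apply/val_inj; rewrite /= hi i0E.
    by rewrite z0 !mulr0.
  by rewrite mul1r -expr2 sqr_ge0.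
pose z := v i0 ord0 *: u - u i0 ord0 *: v.
have zz : lorentz z z = v i0 ord0 ^+ 2 * lorentz u u + u i0 ord0 ^+ 2 * lorentz v v
    - 2 * v i0 ord0 * u i0 ord0 * lorentz u v.
  rewrite !lorentzE !mulr_sumr -big_split -sumrB; apply: eq_bigr => i _.
  by rewrite !mxE /=; ring.
have := nonneg z; rewrite zz uu vv uv !mxE => /(_ (ltac:(ring))) h.
have u0 : u i0 ord0 = 0.
  apply/eqP; rewrite -sqrf_eq0 eq_le sqr_ge0 andbT.
  have := sqr_ge0 (v i0 ord0); lra.
by have := nonneg u u0; rewrite uu; lra.
Qed.

(** * Comparison of a Frenet curve with an oscillating curve *)

Section FrenetCurve.
Context {R : realType} (k : nat) (I : set R) (alpha : R -> 'cV[R]_(2 * k))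
  (e : nat -> R -> 'cV[R]_(2 * k)) (eps : nat -> R) (kappa : nat -> R -> R)
  (sigma : R -> R) (tk : nat -> R).
Local Notation n := (2 * k)%N.
Local Notation f := (frenet_coef tk).
Local Notation M := (shape_mx n eps tk).
Hypothesis k_gt0 : (0 < k)%N.
Hypothesis itvI : is_interval I.
Hypothesis I_neq0 : I !=set0.
Hypothesis frenet : frenet_curve I alpha e eps kappa.
Hypothesis sigma_arc : spherical_arc_length I kappa sigma.
Hypothesis pshape : forall i, (1 <= i <= n.-1)%N ->
  tk i != 0 /\ forall s, I s -> pshape_curvature kappa sigma i s = tk i.
Hypothesis epsK : forall i, eps i * eps i = 1.

Lemma kappa1_neq0 (s : R) : I s -> kappa 1%N s != 0.
Proof.
(* In dimension 2, kappa_1 is the last curvature, which is only assumed nonzero; in higher dimension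
   it is positive. *)
move=> Is; have [k1|k2] := eqVneq k 1%N.
  by have := frenet_kappa_last frenet Is; rewrite k1.
by rewrite gt_eqF // (frenet_kappa_gt0 frenet Is) //; lia.
Qed.

Lemma frenet_coef_neq0 (i : nat) : (0 < i < n)%N -> f i != 0.
Proof.
move=> hi; rewrite /frenet_coef; case: (i =P 1%N) => [_|hi1]; first by rewrite oner_eq0.
by have [] := pshape i _; first lia.
Qed.

Lemma kappaE (i : nat) (s : R) : (0 < i < n)%N -> I s ->
  kappa i s = kappa 1%N s * f i.
Proof.
move=> hi Is; rewrite /frenet_coef; case: eqP => [->|hi1]; first by rewrite mulr1.
have [|_ /(_ s Is)] := pshape i; first by lia.
rewrite /pshape_curvature; case: eqP => // _ <-.
by rewrite mulrCA mulfV ?mulr1 // kappa1_neq0.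
Qed.

(** Constancy of tk_1 means that the arc length derivative of kappa_1 is - tk_1 kappa_1^2, while
    that of sigma is kappa_1. The inverse of [c] becomes the scaling factor in
    [osc_parametrization]. *)
Lemma kappa1_exp : exists2 c : R, c != 0 &
  forall s, I s -> kappa 1%N s * expR (tk 1%N * sigma s) = c.
Proof.
have [s0 Is0] := I_neq0.
exists (kappa 1%N s0 * expR (tk 1%N * sigma s0)).
  by rewrite mulf_neq0 ?kappa1_neq0 // gt_eqF // expR_gt0.
move=> s Is.
have [|tk1 /(_ _ _)hp] := pshape 1; first by lia.
apply: (is_derive0_interval I (fun s => kappa 1%N s * expR (tk 1%N * sigma s))) => // u Iu.
have hs := sigma_arc u Iu.
have hk : is_derive u 1 (kappa 1%N) (- (kappa 1%N u ^+ 2 * tk 1%N)).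
  have hd : derivable (kappa 1%N) u 1.
    by apply: (frenet_kappa_derivable frenet Iu); lia.
  have := hp u Iu; rewrite /pshape_curvature /= !derive1E (derive_val (f := sigma)).
  move=> h; apply: DeriveDef => //.
  by rewrite -h; have := kappa1_neq0 u Iu => k0; field.
apply: (@is_derive_eq _ _ _ ((kappa 1%N) * (fun s => expR (tk 1%N * sigma s)))).
by rewrite /GRing.scale /=; ring.
Qed.

Definition frenet_mx (s : R) : 'M[R]_n := \matrix_(i, j) e i.+1 s j ord0.

Lemma frenet_mx_derive (s : R) (i j : 'I_n) : I s ->
  is_derive s 1 (fun u => frenet_mx u i j) (kappa 1%N s * (M *m frenet_mx s) i j).
Proof.
move=> Is.
have -> : (fun u => frenet_mx u i j) = (fun u => e i.+1 u j ord0).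
  by apply/funext => u; rewrite mxE.
have -> : (M *m frenet_mx s) i j = (M *m \col_l e l.+1 s j ord0) i ord0.
  by rewrite !mxE; apply: eq_bigr => l _; rewrite !mxE.
rewrite (shape_mx_col n eps tk (fun l => e l.+1 s j ord0)).
have [i0|i0] := eqVneq (i : nat) 0%N.
  have h := frenet_first frenet Is j; rewrite i0 /= ifT; last by lia.
  move: h; rewrite mxE => h; apply: is_derive_eq.
  by rewrite /frenet_coef /=; ring.
have [i1|i1] := eqVneq (i : nat) n.-1.
  have h := frenet_last frenet Is j; rewrite i1 prednK ?ltnn; last by lia.
  move: h; rewrite mxE (kappaE n.-1) //; last by lia.
  have -> : shifted (fun l => e l.+1 s j ord0) n.-1 = e n.-1 s j ord0.
    have e1 : n.-1 = n.-2.+1 by lia.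
    by rewrite [X in shifted _ X]e1 /= -e1.
  by move=> h; apply: is_derive_eq; ring.
have h := frenet_middle frenet Is (i := i.+1).
have {}h := h _ j; have {h} := h (ltac:(move: (ltn_ord i); lia)).
rewrite !mxE ifT; last by move: (ltn_ord i); lia.
have -> : shifted (fun l => e l.+1 s j ord0) i = e i s j ord0.
  by case: (i : nat) i0.
rewrite /= (kappaE i) ?(kappaE i.+1) //; try (move: (ltn_ord i); lia).
by move=> h; apply: is_derive_eq; ring.
Qed.

Variables (mu : nat -> R) (y dy : nat -> R -> R).
Hypothesis boundary : forall r, (r < k)%N -> frame_boundary k eps tk (mu r).
Hypothesis y_derive : forall j (s : R), is_derive s 1 (y j) (dy j s).
Hypothesis dy_derive : forall j (s : R), is_derive s 1 (dy j) (mu j./2 * y j s).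
Local Notation osc := (osc_frame k eps tk mu y dy).
Hypothesis gram : forall (i j : nat) s, (i < n)%N -> (j < n)%N ->
  lorentz (osc i s) (osc j s) = if i == j then eps i.+1 else 0.

Definition osc_mx (s : R) : 'M[R]_n := \matrix_(i, j) osc i s j ord0.

Lemma osc_mx_derive (s : R) (i j : 'I_n) :
  is_derive s 1 (fun u => osc_mx u i j) ((M *m osc_mx s) i j).
Proof.
have -> : (fun u => osc_mx u i j) = (fun u => osc i u j ord0).
  by apply/funext => u; rewrite mxE.
have -> : (M *m osc_mx s) i j = (M *m \col_l osc l s j ord0) i ord0.
  by rewrite !mxE; apply: eq_bigr => l _; rewrite !mxE.
rewrite (shape_mx_col n eps tk (fun l => osc l s j ord0)).
have h := osc_frame_derive k eps tk mu y dy y_derive dy_derive i j s.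
apply: is_derive_eq.
have hj : (j./2 < k)%N by move: (ltn_ord j); lia.
pose z := if odd i then osc_tangent tk y dy j s else osc_tangent' tk mu y dy j s.
have hF := shape_mx_frame k eps tk k_gt0 epsK frenet_coef_neq0 (mu j./2) i (boundary _ hj).
transitivity ((if odd i then mu j./2 else 1) * (frame_poly eps tk i).[mu j./2] * z).
  by rewrite /z; case: odd; ring.
rewrite -hF mulrBl; congr (_ - _).
  case: ifP => _; last by rewrite mul0r.
  by rewrite !mxE /z /=; case: odd => /=; ring.
rewrite /z; case: (i : nat) => [|l] /=; first by ring.
by rewrite !mxE; case: odd => /=; ring.
Qed.

Lemma osc_parametrization : has_parametrization I alpha sigma (osc_curve k tk y).
Proof.
have [c c0 kc] := kappa1_exp.
have [A [AL FA]] : exists A : 'M[R]_n, A^T *m lorentz_mx R n *m A = lorentz_mx R n /\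
    forall s, I s -> frenet_mx s = osc_mx (sigma s) *m A^T.
  apply: (congruent_frames n I (kappa 1%N) M (lorentz_mx R n) (\row_i eps i.+1)
            (fun s => osc_mx (sigma s)) frenet_mx) => //.
  - exact: (shape_mx_skewT k eps tk k_gt0 epsK).
  - exact: (sign_mx_sqr k eps epsK).
  - move=> s i j Is; rewrite mulrC.
    exact: (is_derive_comp1 (fun u => osc_mx u i j) sigma _ _ _ (sigma_arc s Is)
              (osc_mx_derive _ _ _)).
  - by move=> s i j; exact: frenet_mx_derive.
  - move=> s Is; apply/matrixP => i j.
    rewrite (lorentz_rows n (fun l => osc l (sigma s))) gram // !mxE.
    by rewrite -val_eqE /=; case: eqP.
  - move=> s Is; apply/matrixP => i j.
    rewrite (lorentz_rows n (fun l => e l.+1 s)) (frenet_orthonormal frenet Is);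
      try (move: (ltn_ord i) (ltn_ord j); lia).
    by rewrite !mxE eqSS -val_eqE /=; case: eqP.
  - exact: tr_diag_mx.
have [s0 Is0] := I_neq0.
have n0 : (0 < n)%N by lia.
(* The translation matches the two curves at [s0]; equality elsewhere follows from equality of
   derivatives. *)
pose b := alpha s0 - c^-1 *: (A *m osc_curve k tk y (sigma s0)).
exists c^-1, A, b; split; [by rewrite invr_eq0| exact: AL | move=> s Is].
suff H j : alpha s j ord0 - c^-1 * (A *m osc_curve k tk y (sigma s)) j ord0 =
    alpha s0 j ord0 - c^-1 * (A *m osc_curve k tk y (sigma s0)) j ord0.
  rewrite /affine_map /b; apply/colP => j; have := H j.
  move: (A *m osc_curve k tk y (sigma s)) (A *m osc_curve k tk y (sigma s0)) => u v.
  by rewrite !mxE => h; lra.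
pose g u := alpha u j ord0 - c^-1 * (A *m osc_curve k tk y (sigma u)) j ord0.
suff dg u : I u -> is_derive u 1 g 0 by exact: (is_derive0_interval I g itvI dg).
move=> Iu.
have gE : g = (fun u => alpha u j ord0) -
    c^-1 *: (\sum_(l < n) A j l *: (fun u => osc_curve k tk y (sigma u) l ord0)).
  apply/funext => v; rewrite /g mxE.
  by rewrite -[RHS]/(alpha v j ord0 - c^-1 * _) fct_sumE.
have ha := frenet_tangent frenet Iu j.
have hl (l : 'I_n) : is_derive u 1 (fun u => osc_curve k tk y (sigma u) l ord0)
    (expR (tk 1%N * sigma u) * osc_tangent tk y dy l (sigma u) * kappa 1%N u).
  apply: (is_derive_comp1 (fun u => osc_curve k tk y u l ord0) sigma).
    exact: sigma_arc.
  exact: osc_curve_derive.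
rewrite gE; apply: is_derive_eq.
(* The first row of the frame identity expresses the tangent of [alpha]. The other curve has speed
   factor kappa_1 exp (tk_1 sigma) = [c], which [c^-1] cancels. *)
have := FA u Iu => /matrixP/(_ (Ordinal n0) j); rewrite !mxE /= => ->.
rewrite /GRing.scale /= mulr_sumr -sumrB big1 // => l _.
rewrite !mxE /= /frame_poly /= hornerC mul1r.
rewrite (_ : expR _ * _ * _ = c * osc_tangent tk y dy l (sigma u)).
  by field.
by rewrite -(kc u Iu); ring.
Qed.

End FrenetCurve.

(** * The explicit forms *)

(** The given signs are known only at the indices 1, ..., n; this and the next lemma allow replacing
    them by [one_timelike], whose values square to 1 at every index. *)
Lemma eq_shape_mx {R : realType} (n : nat) (eps eps' tk : nat -> R) :
  (forall i, (1 <= i <= n)%N -> eps i = eps' i) ->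
  shape_mx n eps tk = shape_mx n eps' tk.
Proof.
move=> h; apply/matrixP => i j; rewrite !mxE.
move: (ltn_ord i) (ltn_ord j) => hi hj.
case: eqP => e1; first by rewrite h //; lia.
by case: eqP => // e2; rewrite h //; lia.
Qed.

Lemma eq_frenet_curve {R : realType} (n : nat) (I : set R) (alpha : R -> 'cV[R]_n)
    (e : nat -> R -> 'cV[R]_n) (eps eps' : nat -> R) (kappa : nat -> R -> R) :
  (1 < n)%N -> (forall i, (1 <= i <= n)%N -> eps i = eps' i) ->
  frenet_curve I alpha e eps kappa -> frenet_curve I alpha e eps' kappa.
Proof.
move=> n1 h [h1 h2 h3 h4 h5 h6 h7 h8 h9]; split => //.
- by move=> i hi; rewrite -h //; exact: h1.
- by move=> s i j Is hi hj; rewrite -h //; exact: h2.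
- by move=> s Is; rewrite -h //; exact: h4.
- by move=> s i Is hi; rewrite -!h; [exact: h5|lia|lia].
- by move=> s Is; rewrite -h; [exact: h6|lia].
Qed.

(** A second negative sign would give two orthogonal timelike vectors. *)
Lemma frenet_one_timelike {R : realType} (n : nat) (I : set R)
    (alpha : R -> 'cV[R]_n) (e : nat -> R -> 'cV[R]_n) (eps : nat -> R)
    (kappa : nat -> R -> R) (j : nat) :
  I !=set0 -> frenet_curve I alpha e eps kappa -> (1 <= j <= n)%N -> eps j = -1 ->
  forall i, (1 <= i <= n)%N -> eps i = one_timelike j i.
Proof.
move=> [s Is] fc hj ej i hi; rewrite /one_timelike; case: eqP => [->//|/eqP ij].
have [//|ei] := frenet_sign fc hi.
have n0 : (0 < n)%N by lia.
have ortho := frenet_orthonormal fc Is.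
case: (orthogonal_timelike_absurd n (Ordinal n0) (e i s) (e j s)) => //.
- by rewrite ortho // eqxx.
- by rewrite ortho // eqxx.
- by rewrite ortho // (negbTE ij).
Qed.

Lemma sign_dot_gt0 {R : realType} (k : nat) (eps v : nat -> R) (j : nat) :
  (forall i, (i < 2 * k)%N -> v i != 0 -> eps i.+1 = 1) ->
  (j < 2 * k)%N -> v j != 0 -> 0 < sign_dot k eps v v.
Proof.
move=> h hj vj; rewrite /sign_dot (bigD1 (Ordinal hj)) //=.
apply: ltr_pwDl.
  by rewrite h // mul1r -expr2 lt0r sqrf_eq0 vj sqr_ge0.
apply: sumr_ge0 => i _; have [->|vi] := eqVneq (v i) 0; first by rewrite mulr0.
by rewrite h // mul1r -expr2 sqr_ge0.
Qed.

(** * Quadrature weights, amplitudes and the quadratic system *)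

Section ExplicitForm.
Context {R : realType} (k : nat) (I : set R) (alpha : R -> 'cV[R]_(2 * k))
  (e : nat -> R -> 'cV[R]_(2 * k)) (kappa : nat -> R -> R)
  (sigma : R -> R) (tk lam : nat -> R) (b : bool).
Local Notation n := (2 * k)%N.
Let eps : nat -> R := one_timelike (if b then 2 else 1).
Local Notation mu := (node lam).
Local Notation t := (frame_poly eps tk).
Hypothesis k_gt0 : (0 < k)%N.
Hypothesis itvI : is_interval I.
Hypothesis I_neq0 : I !=set0.
Hypothesis frenet : frenet_curve I alpha e eps kappa.
Hypothesis sigma_arc : spherical_arc_length I kappa sigma.
Hypothesis pshape : forall i, (1 <= i <= n.-1)%N ->
  tk i != 0 /\ forall s, I s -> pshape_curvature kappa sigma i s = tk i.
Hypothesis eigen : forall i, (1 <= i <= k)%N ->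
  eigenvalue (shape_mx n eps tk *m shape_mx n eps tk) (sq_eigenvalue lam i).
Hypothesis eigen_neq : pairwise_different k (sq_eigenvalue lam).
Hypothesis tk_lam : `|tk 1%N| < lam 1%N.

Let epsK i : eps i * eps i = 1.
Proof. by rewrite /eps /one_timelike; case: ifP => _; rewrite ?mulrNN mulr1. Qed.

Let f_neq0 i : (0 < i < n)%N -> frenet_coef tk i != 0.
Proof. exact: (frenet_coef_neq0 k I kappa sigma tk k_gt0 pshape). Qed.

Let tk_neq0 : tk 1%N != 0.
Proof. by have [] := pshape 1%N _; first lia. Qed.

Let node_neq0_boundary r : (r < k)%N -> mu r != 0 /\ frame_boundary k eps tk (mu r).
Proof.
move=> hr; apply: (shape_mx_sqr_eigenvalue k eps tk k_gt0 epsK f_neq0).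
by apply: eigen; lia.
Qed.

Let node_inj r s : (r < k)%N -> (s < k)%N -> mu r = mu s -> r = s.
Proof.
move=> hr hs h; apply/eqP; apply: contraT => rs.
by have := eigen_neq r.+1 s.+1 hr hs rs; rewrite -/(mu r) h /node eqxx.
Qed.

Let norm r := node_norm k eps tk mu r.

(** The timelike index, counted from 0, is 1 when [b] holds and 0 otherwise. In the first case the
    even parts have spacelike support, so their squares are positive. In the second the odd parts
    do, and [sign_dot_frames] multiplies their positive squares by [- mu r], negative only for
    [r = 0]. *)
Let node_norm_sign r : (r < k)%N ->
  if ~~ b && (r == 0%N) then norm r < 0 else 0 < norm r.
Proof.
move=> hr; have [mu0 bd] := node_neq0_boundary r hr.
rewrite /norm /node_norm; case bE: b => /=.
  apply: (sign_dot_gt0 k eps _ 0) => //; last 2 first.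
  - by lia.
  - by rewrite /even_frame /= /frame_poly /= hornerC oner_eq0.
  move=> i hi; rewrite /even_frame /eps /one_timelike bE.
  by case: i hi => [|[|i]] //=; rewrite eqxx.
have odd_gt0 : 0 < sign_dot k eps (odd_frame eps tk (mu r)) (odd_frame eps tk (mu r)).
  apply: (sign_dot_gt0 k eps _ 1) => //; last 2 first.
  - by lia.
  - rewrite /odd_frame /= frame_poly_horner_rec /= mulr0 add0r mul1r.
    rewrite /frame_poly /= hornerC mulr1 /frenet_coef /= divr1.
    by rewrite /eps /one_timelike bE /= oner_eq0.
  move=> i hi; rewrite /odd_frame /eps /one_timelike bE.
  by case: i hi => [|i] //=; rewrite eqxx.
rewrite (sign_dot_frames k eps tk k_gt0 epsK f_neq0) //.
case: eqP => r0.
  rewrite pmulr_llt0 // oppr_lt0 lt0r mu0 r0 /node /sq_eigenvalue /=.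
  exact: sqr_ge0.
rewrite pmulr_lgt0 // oppr_gt0 lt_neqAle mu0 /node /sq_eigenvalue.
by case: eqP => [|_]; [lia|rewrite oppr_le0 sqr_ge0].
Qed.

Let norm_neq0 r : (r < k)%N -> norm r != 0.
Proof.
by move=> /node_norm_sign; case: ifP => _ h; rewrite ?(lt_eqF h) ?(gt_eqF h).
Qed.

Let form a := osc_curve k tk (form_coord tk lam b a).
Let coord_derive a := form_coord_derive tk lam b a.
Let coord'_derive a := form_coord'_derive tk lam b a.

Let form_frame_gram a s i j :
  lorentz (osc_frame k eps tk mu (form_coord tk lam b a) (form_coord' tk lam b a) i s)
          (osc_frame k eps tk mu (form_coord tk lam b a) (form_coord' tk lam b a) j s) =
  if odd i == odd j then
    \sum_(r < k) form_weight b a r * (if odd i then - mu r else 1) *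
       (t i).[mu r] * (t j).[mu r]
  else 0.
Proof.
apply: lorentz_osc_frame => r hr sg.
exact: (form_coord_planes tk lam tk_lam tk_neq0 b a s r).
Qed.

Let weights_gram a : (forall r, (r < k)%N -> form_weight b a r = (norm r)^-1) ->
  forall i j s, (i < n)%N -> (j < n)%N ->
  lorentz (osc_frame k eps tk mu (form_coord tk lam b a) (form_coord' tk lam b a) i s)
          (osc_frame k eps tk mu (form_coord tk lam b a) (form_coord' tk lam b a) j s) =
  if i == j then eps i.+1 else 0.
Proof.
move=> hw i j s hi hj; rewrite form_frame_gram; case: eqP => oij; last first.
  by case: eqP => // ij; case: oij; rewrite ij.
rewrite -(quadrature k eps tk k_gt0 epsK f_neq0 mu node_inj) //.
- by apply: eq_bigr => r _; rewrite hw.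
- by move=> r hr; case: (node_neq0_boundary r hr).
- by move=> r hr; case: (node_neq0_boundary r hr).
Qed.

(** The weights of any solution and the inverse norms satisfy the same [k] equations, so
    [frame_weights_unique] identifies them. *)
Let weights_of_system a : quadratic_system k eps tk form a ->
  forall r, (r < k)%N -> form_weight b a r = (norm r)^-1.
Proof.
move=> sys; apply: (frame_weights_unique k eps tk k_gt0 epsK f_neq0 mu) => // i hi.
have := sys i.+1 hi 0.
rewrite /form (derived_frame_osc k eps tk mu _ _ (coord_derive a) (coord'_derive a)).
rewrite form_frame_gram eqxx => ->.
rewrite (quadrature k eps tk k_gt0 epsK f_neq0 mu node_inj) ?eqxx //; try lia.
- by move=> r hr; case: (node_neq0_boundary r hr).
- by move=> r hr; case: (node_neq0_boundary r hr).
Qed.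

Let system_of_weights a : (forall r, (r < k)%N -> form_weight b a r = (norm r)^-1) ->
  quadratic_system k eps tk form a.
Proof.
move=> hw [|i] // hi s.
rewrite /form (derived_frame_osc k eps tk mu _ _ (coord_derive a) (coord'_derive a)).
by rewrite weights_gram ?eqxx //; lia.
Qed.

Let weights_parametrization a :
  (forall r, (r < k)%N -> form_weight b a r = (norm r)^-1) ->
  has_parametrization I alpha sigma (form a).
Proof.
move=> hw; rewrite /form.
apply: (osc_parametrization k I alpha e eps kappa sigma tk k_gt0 itvI I_neq0
  frenet sigma_arc pshape epsK mu _ _ _ (coord_derive a) (coord'_derive a)).
  by move=> r hr; case: (node_neq0_boundary r hr).
exact: weights_gram.
Qed.

(** Every solution of the system has the right weights, hence parametrizes [alpha]. So a pairwise
    different nonzero solution is taken if there is one, and otherwise the one given by square roots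
    of the weights. *)
Lemma explicit_form : has_explicit_form k I alpha sigma eps tk form.
Proof.
have weights_form a : (forall i, (1 <= i <= k)%N -> a i != 0) ->
    ((exists a' : nat -> R,
        [/\ forall i, (1 <= i <= k)%N -> a' i != 0,
            pairwise_different k a' & quadratic_system k eps tk form a']) ->
     pairwise_different k a) ->
    (forall r, (r < k)%N -> form_weight b a r = (norm r)^-1) ->
    has_explicit_form k I alpha sigma eps tk form.
  move=> a0 pd hw; exists a; split => //.
    exact: system_of_weights.
  exact: weights_parametrization.
have [[a [a0 pd sys]]|no_diff] := pselect (exists a' : nat -> R,
    [/\ forall i, (1 <= i <= k)%N -> a' i != 0,
        pairwise_different k a' & quadratic_system k eps tk form a']).
  by apply: (weights_form a) => //; exact: weights_of_system.
(* Amplitudes are indexed from 1 and norms from 0. By [node_norm_sign] the sign lost in the absolute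
   value is the one that [form_weight] restores. *)
apply: (weights_form (fun i => Num.sqrt `|(norm i.-1)^-1|)) => //.
  move=> i hi; rewrite gt_eqF // sqrtr_gt0 normr_gt0 invr_eq0.
  by apply: norm_neq0; lia.
move=> r hr; rewrite /form_weight /= sqr_sqrtr ?normr_ge0 //.
have := node_norm_sign r hr; case: ifP => _ hs.
  by rewrite ltr0_norm ?opprK // invr_lt0.
by rewrite gtr0_norm // invr_gt0.
Qed.

End ExplicitForm.

Theorem theorem13 (R : realType) (k : nat) (I : set R)
  (alpha : R -> 'cV[R]_(2 * k)) (e : nat -> R -> 'cV[R]_(2 * k))
  (eps : nat -> R) (kappa : nat -> R -> R) (sigma : R -> R)
  (tk lam : nat -> R) :
  (0 < k)%N ->
  open I -> is_interval I -> I !=set0 ->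
  frenet_curve I alpha e eps kappa ->
  spherical_arc_length I kappa sigma ->
  self_similar I alpha ->
  (forall i, (1 <= i <= (2 * k).-1)%N ->
     tk i != 0 /\ forall s, I s -> pshape_curvature kappa sigma i s = tk i) ->
  (forall i, (1 <= i <= k)%N ->
     eigenvalue (shape_mx (2 * k) eps tk *m shape_mx (2 * k) eps tk)
       (sq_eigenvalue lam i)) ->
  pairwise_different k (sq_eigenvalue lam) ->
  `|tk 1%N| < lam 1%N ->
  (eps 1%N = -1 ->
     has_explicit_form k I alpha sigma (one_timelike 1) tk
       (timelike_form k tk lam)) /\
  (eps 2%N = -1 ->
     has_explicit_form k I alpha sigma (one_timelike 2) tk
       (spacelike_form k tk lam)).
Proof.
move=> k0 oI itvI I0 fc arc _ psh eig neq tl.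
have main (b : bool) : eps (if b then 2 else 1)%N = -1 ->
    has_explicit_form k I alpha sigma (one_timelike (if b then 2 else 1)) tk
      (fun a => osc_curve k tk (form_coord tk lam b a)).
  move=> hb.
  have hj : (1 <= (if b then 2 else 1) <= 2 * k)%N by case: (b); lia.
  have eqE := frenet_one_timelike (2 * k) I alpha e eps kappa _ I0 fc hj hb.
  have n1 : (1 < 2 * k)%N by lia.
  have fc' := eq_frenet_curve (2 * k) I alpha e eps _ kappa n1 eqE fc.
  rewrite (eq_shape_mx (2 * k) eps _ tk eqE) in eig.
  exact: (explicit_form k I alpha e kappa sigma tk lam b k0 itvI I0 fc' arc psh eig neq tl).
(* Both explicit forms unfold to [osc_curve] applied to [form_coord]. *)
split=> h; [exact: (main false)|exact: (main true)].
Qed.
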